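(* Let $N\in\mathbb{N}$ and let $\mathbf{X}=(X_1,\ldots,X_N)^T:(\Omega,\mathcal{F})\to(\mathbb{A}^N,\mathcal{B}^N)$ be an $N$-dimensional random vector with multivariate probability density function $f_{\mathbf{X}}(\mathbf{x})$, satisfying Assumption 1 (stated in the context). Consistent with the probability measure $f_{\mathbf{X}}(\mathbf{x})d\mathbf{x}$, let $\{P_{\mathbf{j}}(\mathbf{x}):|\mathbf{j}|=l,\ \mathbf{j}\in\mathbb{N}_0^N\}$, the set of multivariate orthogonal polynomials of degree $l$, be a basis of $\mathcal{V}_l^N$ for each $l\in\mathbb{N}_0$. Then the set of polynomials from the orthogonal sum $$\bigoplus_{l\in\mathbb{N}_0}\mathrm{span}\{P_{\mathbf{j}}(\mathbf{x}):|\mathbf{j}|=l,\ \mathbf{j}\in\mathbb{N}_0^N\}$$ is dense in $L^2(\mathbb{A}^N,\mathcal{B}^N,f_{\mathbf{X}}d\mathbf{x})$. Moreover, $$L^2(\mathbb{A}^N,\mathcal{B}^N,f_{\mathbf{X}}d\mathbf{x})=\overline{\bigoplus_{l\in\mathbb{N}_0}\mathcal{V}_l^N},$$ where the overline denotes set closure.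
   Context: $\mathbb{N}_0=\{0,1,2,\ldots\}$. $(\Omega,\mathcal{F},\mathbb{P})$ is a complete probability space, $\mathbb{A}^N\subseteq\mathbb{R}^N$ is a bounded or unbounded subdomain, and $\mathcal{B}^N$ is its Borel $\sigma$-algebra. $L^2(\mathbb{A}^N,\mathcal{B}^N,f_{\mathbf{X}}d\mathbf{x})$ is the Hilbert space of real-valued functions on $\mathbb{A}^N$ that are square-integrable with respect to $f_{\mathbf{X}}(\mathbf{x})d\mathbf{x}$. The symbol $\oplus$ denotes the (algebraic) orthogonal sum of subspaces, i.e. finite sums of elements of mutually orthogonal subspaces. Assumption 1. The random vector $\mathbf{X}:(\Omega,\mathcal{F})\to(\mathbb{A}^N,\mathcal{B}^N)$ (1) has an absolutely continuous joint distribution function and a continuous joint probability density function $f_{\mathbf{X}}$ with bounded or unbounded support $\mathbb{A}^N\subseteq\mathbb{R}^N$; (2) has absolute finite moments of all orders, i.e. $\int_{\mathbb{A}^N}|\mathbf{x}^{\mathbf{j}}|f_{\mathbf{X}}(\mathbf{x})d\mathbf{x}<\infty$ for all $\mathbf{j}\in\mathbb{N}_0^N$, where $\mathbf{x}^{\mathbf{j}}=x_1^{j_1}\cdots x_N^{j_N}$; (3) has a density $f_{\mathbf{X}}$ which either (a) has compact support, i.e. there is a compact subset $\mathbb{A}^N\subset\mathbb{R}^N$ with $\mathbb{P}(\mathbf{X}\in\mathbb{A}^N)=1$, or (b) is exponentially integrable, i.e. there is a real $\alpha>0$ with $\int_{\mathbb{A}^N}\exp(\alpha\|\mathbf{x}\|)f_{\mathbf{X}}(\mathbf{x})d\mathbf{x}<\infty$,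 where $\|\cdot\|$ is an arbitrary norm. For $\mathbf{j}=(j_1,\ldots,j_N)\in\mathbb{N}_0^N$, $|\mathbf{j}|=j_1+\cdots+j_N$. $\Pi_m^N=\mathrm{span}\{\mathbf{x}^{\mathbf{j}}:|\mathbf{j}|\le m\}$ and $\Pi^N=\mathbb{R}[x_1,\ldots,x_N]$. The inner product on $\Pi^N$ is $(P,Q)_{f_{\mathbf{X}}d\mathbf{x}}=\int_{\mathbb{A}^N}P(\mathbf{x})Q(\mathbf{x})f_{\mathbf{X}}(\mathbf{x})d\mathbf{x}$. $\mathcal{V}_0^N=\mathrm{span}\{1\}$ and, for $l\ge1$, $\mathcal{V}_l^N=\{P\in\Pi_l^N:(P,Q)_{f_{\mathbf{X}}d\mathbf{x}}=0\ \forall Q\in\Pi_{l-1}^N\}$. Let $K_{N,l}=\binom{N+l-1}{l}$ be the number of multi-indices with $|\mathbf{j}|=l$, listed in a chosen monomial order as $\mathbf{j}^{(1)},\ldots,\mathbf{j}^{(K_{N,l})}$, and let $\mathbf{x}_l=(\mathbf{x}^{\mathbf{j}^{(1)}},\ldots,\mathbf{x}^{\mathbf{j}^{(K_{N,l})}})^T$. Multivariate orthogonal polynomials consistent with $f_{\mathbf{X}}(\mathbf{x})d\mathbf{x}$: a family $\{P_{\mathbf{j}}:\mathbf{j}\in\mathbb{N}_0^N\}$ with $P_{\mathbf{0}}=1$ and $P_{\mathbf{j}}\in\Pi_{|\mathbf{j}|}^N$, such that for each $l$ the column vector $\mathbf{P}_l(\mathbf{x})=(P_{\mathbf{j}^{(1)}}(\mathbf{x}),\ldots,P_{\mathbf{j}^{(K_{N,l})}}(\mathbf{x}))^T$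 satisfies $\int_{\mathbb{A}^N}\mathbf{x}_r\mathbf{P}_l^T(\mathbf{x})f_{\mathbf{X}}(\mathbf{x})d\mathbf{x}=\mathbf{0}$ for all $r<l$, and the $K_{N,l}\times K_{N,l}$ matrix $\mathbf{S}_l=\int_{\mathbb{A}^N}\mathbf{x}_l\mathbf{P}_l^T(\mathbf{x})f_{\mathbf{X}}(\mathbf{x})d\mathbf{x}$ is invertible. *)

(* Defs.v *)
(* MathComp-Analysis, with multinomials for polynomials in N variables; the
   notations of mpoly clash with those of MathComp-Analysis and are left out. *)
From HB Require Import structures.
From mathcomp Require Import all_boot all_order all_algebra.
From mathcomp Require Import -(notations) mpoly.
From mathcomp Require Import all_classical all_reals all_analysis.
From mathcomp Require Import measurable_realfun.

Set Implicit Arguments.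
Unset Strict Implicit.
Unset Printing Implicit Defensive.
Import Order.TTheory GRing.Theory Num.Theory.
Import numFieldNormedType.Exports.
Local Open Scope classical_set_scope.
Local Open Scope ring_scope.

(* R^n is 'rV[R]_n with its Borel sigma-algebra. *)
HB.instance Definition _ (R : realType) (m n : nat) :=
  @isMeasurable.Build (sigma_display (@open 'M[R]_(m, n))) 'M[R]_(m, n)
    <<s @open 'M[R]_(m, n) >> (@sigma_algebra0 _ setT _)
    (@sigma_algebraC _ _) (@sigma_algebra_bigcup _ setT _).

Section borel_rV.
Context {R : realType}.
Implicit Types n : nat.

Lemma measurable_open_rV n (U : set 'rV[R]_n) : open U -> measurable U.
Proof. exact: sub_sigma_algebra. Qed.

Lemma measurable_coord n (i : 'I_n) :
  measurable_fun setT (fun x : 'rV[R]_n => x 0 i).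
Proof.
apply: (measurability _ (RGenOInfty.measurableE R)) => _ [_ [a ->] <-].
rewrite setTI; apply: measurable_open_rV.
by apply: open_comp; [move=> x _; exact: coord_continuous|exact: interval_open].
Qed.

Lemma open_rV_box n (U : set 'rV[R]_n) : open U ->
  exists D : set ('rV[rat]_n * 'rV[rat]_n),
  U = \bigcup_(q in D)
    [set x | forall i, ratr (q.1 0 i) < x 0 i < ratr (q.2 0 i)].
Proof.
move=> oU; pose box (q : 'rV[rat]_n * 'rV[rat]_n) :=
  [set x : 'rV[R]_n | forall i, ratr (q.1 0 i) < x 0 i < ratr (q.2 0 i)].
exists [set q | box q `<=` U]; apply/seteqP.
split => [x Ux|x [q /= qU]]; last exact: qU.
have /nbhs_ballP[e /= e0 xeU] : nbhs x U by exact: open_nbhs_nbhs.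
have lo i : exists q : rat, x 0 i - e < ratr q < x 0 i.
  have [q] := @rat_in_itvoo R (x 0 i - e) (x 0 i) ltac:(by rewrite gtrBl).
  by rewrite in_itv/=; exists q.
have hi i : exists q : rat, x 0 i < ratr q < x 0 i + e.
  have [q] := @rat_in_itvoo R (x 0 i) (x 0 i + e) ltac:(by rewrite ltrDl).
  by rewrite in_itv/=; exists q.
have [a aP] := choice lo; have [b bP] := choice hi.
exists (\row_i a i, \row_i b i); last first.
  by move=> i; rewrite !mxE; case/andP: (aP i) => _ ->; case/andP: (bP i).
move=> y /= yq; apply: xeU; split => // j i; rewrite !ord1 /ball/=.
have := yq i; rewrite !mxE => /andP[ay yb].
have /andP[xa _] := aP i; have /andP[_ bx] := bP i.
rewrite ltr_distlC (lt_trans xa ay)/=; exact: lt_trans yb bx.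
Qed.

Lemma measurable_fun_rV d (T : measurableType d) n (f : T -> 'rV[R]_n) :
  (forall i, measurable_fun setT (fun t => f t 0 i)) -> measurable_fun setT f.
Proof.
move=> mf; apply: (@measurability _ _ _ _ setT f (@open 'rV[R]_n)) => //.
move=> _ [_ /open_rV_box[D ->] <-]; rewrite setTI preimage_bigcup.
rewrite bigcup_mkcond; apply: countable_bigcupT_measurable => // q.
case: ifP => // _.
rewrite (_ : _ @^-1` _ = \bigcap_(i in [set: 'I_n])
   ((fun t => f t 0 i) @^-1` `]ratr (q.1 0 i), ratr (q.2 0 i)[%classic)).
  apply: fin_bigcap_measurable => // i _; rewrite -[X in measurable X]setTI.
  exact: mf.
apply/seteqP; split => [t ft i _|t ft i].
  by rewrite /= in_itv/=; exact: ft.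
by have := ft i Logic.I; rewrite /= in_itv.
Qed.

End borel_rV.

Section lebesgue_rV.
Context {R : realType}.
Local Open Scope ereal_scope.

Definition cons_rV n (x : measurableTypeR R * 'rV[R]_n) : 'rV[R]_n.+1 :=
  \row_i oapp (x.2 ord0) x.1 (unlift ord0 i).

Definition uncons_rV n (x : 'rV[R]_n.+1) : measurableTypeR R * 'rV[R]_n :=
  (x ord0 ord0, \row_i x ord0 (lift ord0 i)).

Lemma cons_rVK n : cancel (@cons_rV n) (@uncons_rV n).
Proof.
move=> [a v]; rewrite /uncons_rV /cons_rV !mxE unlift_none/=; congr pair.
by apply/rowP => i; rewrite !mxE liftK.
Qed.

Lemma measurable_cons_rV n : measurable_fun setT (@cons_rV n).
Proof.
apply: measurable_fun_rV => i; case: (unliftP ord0 i) => [j|] ->.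
  apply: (eq_measurable_fun
    (fun x : measurableTypeR R * 'rV[R]_n => x.2 ord0 j)).
    by move=> x _; rewrite /cons_rV mxE liftK.
  by apply: (measurableT_comp (measurable_coord j)); exact: measurable_snd.
apply: (eq_measurable_fun (fun x : measurableTypeR R * 'rV[R]_n => x.1)).
  by move=> x _; rewrite /cons_rV mxE unlift_none.
exact: measurable_fst.
Qed.

Lemma measurable_uncons_rV n : measurable_fun setT (@uncons_rV n).
Proof.
apply: measurable_fun_pair; first exact: measurable_coord.
apply: measurable_fun_rV => i.
apply: (eq_measurable_fun (fun x : 'rV[R]_n.+1 => x ord0 (lift ord0 i))).
  by move=> x _; rewrite mxE.
exact: measurable_coord.
Qed.

Section step.
Variables (n : nat) (mu : {sigma_finite_measure set 'rV[R]_n -> \bar R}).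

Definition lebesgue_rVS : set 'rV[R]_n.+1 -> \bar R :=
  pushforward (@lebesgue_measure R \x mu) (@cons_rV n).

Let lebesgue_rVS0 : lebesgue_rVS set0 = 0.
Proof. by rewrite /lebesgue_rVS /pushforward preimage_set0 measure0. Qed.

Let lebesgue_rVS_ge0 A : 0 <= lebesgue_rVS A.
Proof. exact: integral_ge0. Qed.

Let lebesgue_rVS_sigma_additive : semi_sigma_additive lebesgue_rVS.
Proof.
exact: (@measure_semi_sigma_additive _ _ _
  (measure_function_pushforward__canonical__measure_function_Measure
    (lebesgue_measure \x mu) (@measurable_cons_rV n))).
Qed.

HB.instance Definition _ := isMeasure.Build _ _ _ lebesgue_rVS
  lebesgue_rVS0 lebesgue_rVS_ge0 lebesgue_rVS_sigma_additive.

Let lebesgue_rVS_sigma_finite : sigma_finite setT lebesgue_rVS.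
Proof.
have /sigma_finiteP[F [TF ndF Foo]] := sigma_finiteT (@lebesgue_measure R).
have /sigma_finiteP[G [TG ndG Goo]] := sigma_finiteT mu.
exists (fun k => @uncons_rV n @^-1` (F k `*` G k)).
  rewrite -preimage_bigcup (_ : \bigcup_k _ = setT) ?preimage_setT//.
  rewrite -setXTT TF TG predeqE => -[x y]; split.
    by move=> [k _ []/= ? ?]; split; exists k.
  move=> [/= [k _ Fkx] [l _ Gly]]; exists (maxn k l) => //; split.
  - by move: x Fkx; exact/subsetPset/ndF/leq_maxl.
  - by move: y Gly; exact/subsetPset/ndG/leq_maxr.
move=> k; have [mFk Fk] := Foo k; have [mGk Gk] := Goo k; split.
  rewrite -[X in measurable X]setTI; apply: measurable_uncons_rV => //.
  exact: measurableX.
rewrite /lebesgue_rVS /pushforward -comp_preimage.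
rewrite (_ : _ \o _ = id).
  by rewrite preimage_id product_measure1E// lte_mul_pinfty// ge0_fin_numE.
by apply/funext => x; exact: cons_rVK.
Qed.

HB.instance Definition _ := Measure_isSigmaFinite.Build _ _ _ lebesgue_rVS
  lebesgue_rVS_sigma_finite.

End step.

(* Lebesgue measure on R^n: iterated product of the one on R; R^0 is a point. *)
Fixpoint lebesgue_rV n : {sigma_finite_measure set 'rV[R]_n -> \bar R} :=
  if n is n'.+1 then lebesgue_rVS (lebesgue_rV n') else \d_(0%R : 'rV[R]_0).

Lemma measurable_box n (a b : 'I_n -> R) :
  measurable [set x : 'rV[R]_n | forall i, x ord0 i \in `[a i, b i]%R].
Proof.
rewrite (_ : mkset _ = \bigcap_(i in [set: 'I_n])
    ((fun x : 'rV[R]_n => x ord0 i) @^-1` `[a i, b i])).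
  apply: fin_bigcap_measurable => // i _; rewrite -[X in measurable X]setTI.
  exact: measurable_coord.
by apply/seteqP; split => [x xab i _|x xab i]; [exact: xab|exact: xab i I].
Qed.

Lemma lebesgue_rV_box n (a b : 'I_n -> R) : (forall i, a i <= b i)%R ->
  lebesgue_rV n [set x | forall i, x ord0 i \in `[a i, b i]] =
  (\prod_(i < n) (b i - a i))%:E.
Proof.
elim: n a b => [|n IH] a b ab.
  rewrite big_ord0 /= diracE mem_set//=; by case.
rewrite big_ord_recl EFinM.
rewrite -(IH (a \o lift ord0) (b \o lift ord0)); last by move=> i; exact: ab.
rewrite /= /lebesgue_rVS /pushforward.
pose A : set (measurableTypeR R) := [set` `[a ord0, b ord0]].
pose B := [set x : 'rV[R]_n |
  forall i, x ord0 i \in `[a (lift ord0 i), b (lift ord0 i)]%R].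
transitivity ((@lebesgue_measure R \x lebesgue_rV n) (A `*` B)).
  congr (_ _); apply/seteqP; split => [[t v]/= H|[t v]/= [t0 H] i].
    split=> [|i]; first by have := H ord0; rewrite mxE unlift_none.
    by have := H (lift ord0 i); rewrite mxE liftK.
  by rewrite mxE; case: (unliftP ord0 i) => [j|] -> //=; exact: H.
rewrite product_measure1E; [|exact: measurable_itv|exact: measurable_box].
congr (_ * _); apply: etrans (lebesgue_measure_itv `[a ord0, b ord0]%R) _.
rewrite /= lte_fin.
case: ltP => // ba; rewrite (_ : b ord0 = a ord0) ?subrr//.
by apply/le_anti; rewrite ba ab.
Qed.

End lebesgue_rV.

Section mdensity.
Context d (T : measurableType d) (R : realType).
Variables (mu : {measure set T -> \bar R}) (f : {mfun T >-> R}).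
Hypothesis f0 : forall x, 0 <= f x.
Local Open Scope ereal_scope.

Definition mdensity (_ : forall x, (0 <= f x)%R) : set T -> \bar R :=
  fun B => \int[mu]_(x in B) (f x)%:E.

Let mdensity0 : mdensity f0 set0 = 0.
Proof. exact: integral_set0. Qed.

Let mdensity_ge0 B : 0 <= mdensity f0 B.
Proof. by apply: integral_ge0 => x _; rewrite lee_fin. Qed.

Let mdensity_sigma_additive : semi_sigma_additive (mdensity f0).
Proof.
move=> F mF tF mUF; rewrite /mdensity ge0_integral_bigcup//.
- by apply: is_cvg_ereal_nneg_natsum => k _; exact: mdensity_ge0.
- by apply/measurable_EFinP; exact: measurable_funTS.
- by move=> x _; rewrite lee_fin.
Qed.

HB.instance Definition _ := isMeasure.Build _ _ _ (mdensity f0)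
  mdensity0 mdensity_ge0 mdensity_sigma_additive.

End mdensity.

(* The L^p distance on the library's L^p space of almost-everywhere classes. *)
Section Lspace_pseudometric.
Context d (T : measurableType d) (R : realType).
Variables (mu : {measure set T -> \bar R}) (p : \bar R) (p1 : (1 <= p)%E).

HB.instance Definition _ := gen_eqMixin (LspaceType mu p1).
HB.instance Definition _ := gen_choiceMixin (LspaceType mu p1).

Definition Lspace_ball (f : LspaceType mu p1) (e : R) :
    set (LspaceType mu p1) :=
  [set g : LspaceType mu p1 | (Lnorm mu p (fun x => (f x - g x)%:E) < e%:E)%E].

Let measurable_diff (f g : LspaceType mu p1) :
  measurable_fun setT (fun x => f x - g x : R).
Proof.
by apply: measurable_funB;
  [exact: (measurable_funPT (repr (f : {mfun_ mu, T >-> measurableTypeR R})))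
  |exact: (measurable_funPT (repr (g : {mfun_ mu, T >-> measurableTypeR R})))].
Qed.

Let ball_center f (e : R) : 0 < e -> Lspace_ball f e f.
Proof.
move=> e0; rewrite /Lspace_ball/=.
rewrite (_ : (fun x => _) = cst 0%E); last by apply/funext => x; rewrite subrr.
by rewrite Lnorm0 ?lte_fin// gt_eqF// (lt_le_trans _ p1).
Qed.

Let ball_sym f g (e : R) : Lspace_ball f e g -> Lspace_ball g e f.
Proof.
rewrite /Lspace_ball/= -oppe_Lnorm; congr (_ < _)%E; congr Lnorm.
apply/funext => x.
by rewrite -[RHS](congr1 EFin (opprB (f x : R) (g x : R))) EFinN.
Qed.

Let ball_triangle f g h (e1 e2 : R) :
  Lspace_ball f e1 g -> Lspace_ball g e2 h -> Lspace_ball f (e1 + e2) h.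
Proof.
rewrite /Lspace_ball/= => fg gh; rewrite EFinD.
apply: le_lt_trans (lteD fg gh).
rewrite (_ : (fun x => (f x - h x)%:E) =
  EFin \o ((fun x => f x - g x) \+ (fun x => g x - h x))).
  exact: eminkowski.
by apply/funext => x /=; rewrite addrA subrK.
Qed.

HB.instance Definition _ := hasNbhs.Build (LspaceType mu p1)
  (nbhs_ (entourage_ Lspace_ball)).
HB.instance Definition _ := Nbhs_isPseudoMetric.Build R (LspaceType mu p1)
  erefl ball_center ball_sym ball_triangle erefl.

End Lspace_pseudometric.

Section setting.
Context {R : realType} {N : nat}.
Local Notation RN := 'rV[R]_N.
Local Notation lambda := (lebesgue_rV N).

(* A nonempty open connected set, together with any part of its boundary: this
   covers open sets such as R^N as well as closed ones such as boxes. *)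
Definition subdomain (A : set RN) := exists D : set RN,
  [/\ D !=set0, open D, connected D, D `<=` A & A `<=` closure D].

Definition is_norm (nrm : RN -> R) :=
  [/\ forall x y, nrm (x + y) <= nrm x + nrm y,
      forall a x, nrm (a *: x) = `|a| * nrm x
    & forall x, nrm x = 0 -> x = 0].

Definition monomial (j : multinom N) (x : RN) : R :=
  \prod_(i < N) x ord0 i ^+ j i.

Definition peval (p : mpoly N R) (x : RN) : R := meval (x ord0) p.

(* The density f is defined on all of R^N and vanishes off its support A; the
   continuity is relative to A (the uniform density on a box is allowed), and A
   is the support up to boundary points. *)
Record density_assumption d (Omega : measurableType d) (P : probability Omega R)
    (A : set RN) (X : {RV P >-> RN}) (f : RN -> R) : Prop := {
  da_abs_continuous : distribution P X `<< lambda ;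
  da_density : forall B, measurable B ->
    distribution P X B = (\int[lambda]_(x in B) (f x)%:E)%E ;
  da_continuous : {within A, continuous f} ;
  da_vanish : forall x, ~ A x -> f x = 0 ;
  da_support : closure [set x | f x != 0] = closure A ;
  da_moments : forall j : multinom N,
    (\int[lambda]_(x in A) (`|monomial j x| * f x)%:E < +oo)%E ;
  da_tail :
    (exists2 K : set RN, compact K & P (X @^-1` K) = 1%E) \/
    (exists nrm : RN -> R, is_norm nrm /\ exists2 alpha : R, 0 < alpha &
      (\int[lambda]_(x in A) (expR (alpha * nrm x) * f x)%:E < +oo)%E) }.

(* The measure f(x)dx on A, seen as a measure on R^N carried by A. *)
Definition density_on (f : {mfun RN >-> R}) (f0 : forall x, 0 <= f x)
    (A : set RN) (mA : measurable A) : {measure set RN -> \bar R} :=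
  mrestr (mdensity lambda f0) mA.

Definition lspan (V : lmodType R) (S : set V) : set V :=
  [set v | exists n (c : 'I_n -> R) (s : 'I_n -> V),
    (forall i, S (s i)) /\ v = \sum_(i < n) c i *: s i].

Definition basis_of_subspace (V : lmodType R) (I : eqType) (J : set I)
    (b : I -> V) (W : set V) :=
  (forall (s : seq I) (c : I -> R), uniq s -> (forall i, i \in s -> J i) ->
    \sum_(i <- s) c i *: b i = 0 -> forall i, i \in s -> c i = 0) /\
  lspan (b @` J) = W.

Definition degree_set (l : nat) : set (multinom N) := [set j | mdeg j = l].

Definition Pi (m : nat) : set (mpoly N R) :=
  lspan [set mpolyX R j | j in [set j : multinom N | (mdeg j <= m)%N]].

Section orthogonality.
Variables (A : set RN) (f : RN -> R).

Definition inner (p q : mpoly N R) : R :=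
  \int[lambda]_(x in A) (peval p x * peval q x * f x).

Definition Vspace (l : nat) : set (mpoly N R) :=
  if l is l'.+1
  then [set p | Pi l p /\ forall q, Pi l' q -> inner p q = 0]
  else lspan [set 1].

Definition nb_monomials (l : nat) := 'C(N + l - 1, l).

(* e l lists the multi-indices of degree l, without repetition. *)
Definition monomial_listing
    (e : forall l, 'I_(nb_monomials l) -> multinom N) :=
  forall l, injective (e l) /\ range (e l) = degree_set l.

(* The matrix of the integrals of x_r P_l^T with respect to f(x)dx. *)
Definition moment_mx (e : forall l, 'I_(nb_monomials l) -> multinom N)
    (P : multinom N -> mpoly N R) (r l : nat) :
    'M[R]_(nb_monomials r, nb_monomials l) :=
  \matrix_(i, k)
    \int[lambda]_(x in A) (monomial (e r i) x * peval (P (e l k)) x * f x).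

Record orthogonal_polynomials (e : forall l, 'I_(nb_monomials l) -> multinom N)
    (P : multinom N -> mpoly N R) : Prop := {
  op_zero : P mnm0 = 1 ;
  op_degree : forall j, Pi (mdeg j) (P j) ;
  op_orthogonal : forall r l, (r < l)%N -> moment_mx e P r l = 0 ;
  op_invertible : forall l, moment_mx e P l l \in unitmx }.

Definition mutually_orthogonal (W : nat -> set (mpoly N R)) :=
  forall k l p q, k != l -> W k p -> W l q -> inner p q = 0.

End orthogonality.

Definition algebraic_sum (W : nat -> set (mpoly N R)) : set (mpoly N R) :=
  [set p | exists n (q : nat -> mpoly N R),
    (forall l, W l (q l)) /\ p = \sum_(l < n) q l].

(* The classes in L^2 of the polynomials in S. *)
Definition L2_classes (mu : {measure set RN -> \bar R}) (S : set (mpoly N R)) :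
    set (LspaceType2 mu) :=
  [set g | exists2 p, S p & {ae mu, forall x, g x = peval p x}].

End setting.
Arguments L2_classes {R N} mu S.

(* Main.v *)
Require Import Defs.
From HB Require Import structures.
From mathcomp Require Import all_boot all_order all_algebra.
From mathcomp Require Import -(notations) mpoly.
From mathcomp Require Import all_classical all_reals all_analysis.
From mathcomp Require Import measurable_realfun.
From mathcomp Require Import ring lra.

(** Polynomials are dense in the L2 space of an exponentially integrable law,
    and every polynomial is a finite sum of elements of the spaces V_l, which
    are mutually orthogonal; the P_j of degree l span V_l.

    The algebraic half is Gram-Schmidt: a polynomial of degree at most l + 1
    differs from its projection on Pi_l by an element of V_(l+1), and one
    concludes by induction on the degree ([algebraic_sum_Vspace]). The inner
    product of polynomials is only known to be semi-definite, but projections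
    on the span of finitely many vectors exist for such forms too
    ([semidefinite_projection]).

    The analytic half replaces the usual argument, in which the Fourier
    transform of a function orthogonal to all polynomials is analytic and
    vanishes to infinite order at 0, by a direct construction. Let V be the
    closure of the polynomials in the mean square, and call multiplier a
    bounded measurable function h such that h V is contained in V. Multipliers
    form an algebra stable under bounded pointwise limits, by dominated
    convergence. If exp (delta |q|) is integrable for a polynomial q, then sin
    (s q) is a multiplier for small s > 0: its Taylor polynomials in q,
    multiplied by a polynomial p, stay in V and are dominated by the
    square-integrable function |p| exp (s |q|) ([L2multiplier_sin]). The sign
    of a multiplier with values in [-1, 1] is a multiplier, as a limit of
    polynomials ([L2multiplier_sg]); letting s tend to 0, so is the sign of q
    ([multiplier_set_gt0]). The sets whose indicator is a multiplier form a
    sigma-algebra, which contains the half-spaces x_i > a and therefore all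
    Borel sets. Hence V contains all simple functions, and so all
    square-integrable functions ([L2closure_polynomials]).

    The assumption on the density enters through two facts: all polynomials
    are integrable, and exp (delta |x_i|) is integrable for some delta > 0,
    which follows from the equivalence of norms or from the boundedness of the
    support ([density_assumption_exp_integrable]). *)

Set Implicit Arguments.
Unset Strict Implicit.
Unset Printing Implicit Defensive.
Import Order.TTheory GRing.Theory Num.Theory.
Import numFieldNormedType.Exports.
Local Open Scope classical_set_scope.
Local Open Scope ring_scope.

(** * The sign iteration *)

Section sign_iteration.
Context {R : realType}.
Implicit Types y : R.

(** The Newton-Schulz step (the method of Newton for 1 / y ^+ 2 = 1): -1 and 1
    are attracting fixed points and 0 is a repelling one, so the iterates of a
    point of [-1, 1] tend to its sign. Since the step is a polynomial, the
    sign is a pointwise limit of polynomials on [-1, 1]. *)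
Definition sign_step y : R := y * (3 - y ^+ 2) / 2.

Lemma sign_stepN y : sign_step (- y) = - sign_step y.
Proof. by rewrite /sign_step sqrrN mulNr mulNr. Qed.

Lemma iter_sign_stepN n y : iter n sign_step (- y) = - iter n sign_step y.
Proof. by elim: n => //= n ->; rewrite sign_stepN. Qed.

Lemma iter_sign_step_itv n y : 0 < y <= 1 -> y <= iter n sign_step y <= 1.
Proof.
move=> /andP[y0 y1]; elim: n => [|n] /=; first by rewrite lexx.
move: (iter n _ _) => z /andP[yz z1]; rewrite /sign_step.
have z0 : 0 < z by lra.
have ->: z * (3 - z ^+ 2) / 2 = z + z * (1 - z) * (1 + z) / 2 by field.
apply/andP; split.
  rewrite (le_trans yz)// lerDl divr_ge0 ?mulr_ge0//; lra.
rewrite -subr_ge0.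
have -> : 1 - (z + z * (1 - z) * (1 + z) / 2) = (1 - z) * (1 - z) * (2 + z) / 2
  by field.
by rewrite divr_ge0 ?mulr_ge0//; lra.
Qed.

(** One step multiplies the distance 1 - z to the fixed point 1 by 1 - z * (1
    + z) / 2, which is at most 1 - y / 2 as the iterates z stay above the
    starting point y. *)
Lemma iter_sign_step_dist n y : 0 < y <= 1 ->
  1 - iter n sign_step y <= (1 - y / 2) ^+ n.
Proof.
move=> y01; elim: n => [|n IH] /=.
  by rewrite expr0; move/andP : y01 => []; lra.
have /andP[yz z1] := iter_sign_step_itv n y01.
move: (iter n _ _) IH yz z1 => z IH yz z1; move/andP : y01 => [y0 y1].
rewrite exprS; apply: le_trans (ler_wpM2l _ IH); last lra.
have -> : 1 - sign_step z = (1 - z * (1 + z) / 2) * (1 - z).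
  by rewrite /sign_step; field.
apply: ler_wpM2r; first lra.
rewrite lerD2l lerN2 ler_pM2r ?invr_gt0//.
by rewrite -[y]mulr1 ler_pM//; lra.
Qed.

Lemma cvg_iter_sign_step y : `|y| <= 1 ->
  iter n sign_step y @[n --> \oo] --> Num.sg y.
Proof.
have pos (z : R) : 0 < z <= 1 -> iter n sign_step z @[n --> \oo] --> (1 : R).
  move=> z01; apply: (@squeeze_cvgr _ _ _ _ (fun n => 1 - (1 - z / 2) ^+ n)
    (cst 1)); last 2 first.
  - rewrite -[X in _ --> X]subr0; apply: cvgB; first exact: cvg_cst.
    by apply: cvg_expr; rewrite ger0_norm; move/andP : z01 => []; lra.
  - exact: cvg_cst.
  apply: nearW => n; have /andP[_ ->] := iter_sign_step_itv n z01.
  by rewrite andbT lerBlDl -lerBlDr iter_sign_step_dist.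
case: (sgrP y) => [-> _|y0|y0].
- rewrite (_ : (fun _ => _) = cst 0); first exact: cvg_cst.
  by apply/funext => n; elim: n => //= n ->; rewrite /sign_step !mul0r.
- by move=> y1; apply: pos; rewrite y0.
- move=> y1; rewrite (_ : (fun _ => _) =
    (fun n => - iter n sign_step (- y))).
    by apply: cvgN; apply: pos; rewrite oppr_gt0 y0.
  by apply/funext => n; rewrite iter_sign_stepN opprK.
Qed.

Lemma iter_sign_step_norm n y : `|y| <= 1 -> `|iter n sign_step y| <= 1.
Proof.
wlog y0 : y / 0 <= y => [H|].
  have [/H//|y0] := leP 0 y; rewrite -normrN => /H; rewrite oppr_ge0 (ltW y0).
  by rewrite iter_sign_stepN normrN; exact.
rewrite ger0_norm// => y1; move: y0; rewrite le_eqVlt => /predU1P[<-|y0].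
  rewrite (_ : iter _ _ _ = 0) ?normr0//.
  by elim: n => //= n ->; rewrite /sign_step !mul0r.
have /andP[h1 h2] := iter_sign_step_itv n (introT andP (conj y0 y1)).
by rewrite ger0_norm// (le_trans _ h1)// ltW.
Qed.

End sign_iteration.

(** * Square integrals and closures in the mean square *)

Section square_integral.
Context d (T : measurableType d) (R : realType).
Variable mu : {measure set T -> \bar R}.
Implicit Types f g h : T -> R.

Definition sqint f : \bar R := (\int[mu]_x ((f x) ^+ 2)%:E)%E.

Definition square_integrable f :=
  measurable_fun setT f /\ (sqint f < +oo)%E.

Lemma measurable_sqr f : measurable_fun setT f ->
  measurable_fun setT (fun x => ((f x) ^+ 2)%:E).
Proof. by move=> mf; apply/measurable_EFinP; exact: measurable_funX. Qed.

Lemma sqint_ge0 f : (0 <= sqint f)%E.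
Proof. by apply: integral_ge0 => x _; rewrite lee_fin sqr_ge0. Qed.

Lemma le_sqint f g : measurable_fun setT f -> measurable_fun setT g ->
  (forall x, `|f x| <= `|g x|) -> (sqint f <= sqint g)%E.
Proof.
move=> mf mg fg; apply: ge0_le_integral => //.
- by move=> x _; rewrite lee_fin sqr_ge0.
- exact: measurable_sqr.
- exact: measurable_sqr.
- by move=> x _; rewrite lee_fin -(real_normK (num_real (f x)))
    -(real_normK (num_real (g x))) lerXn2r ?nnegrE.
Qed.

Lemma sqintZ a f : measurable_fun setT f ->
  sqint (fun x => a * f x) = ((a ^+ 2)%:E * sqint f)%E.
Proof.
move=> mf; rewrite /sqint; under eq_integral do rewrite exprMn EFinM.
rewrite ge0_integralZl_EFin ?sqr_ge0//.
  by move=> x _; rewrite lee_fin sqr_ge0.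
exact: measurable_sqr.
Qed.

Lemma sqintD f g : measurable_fun setT f -> measurable_fun setT g ->
  (sqint (fun x => f x + g x)%R <= 2%:E * (sqint f + sqint g))%E.
Proof.
move=> mf mg; have mf2 := measurable_sqr mf; have mg2 := measurable_sqr mg.
rewrite -ge0_integralD//; last 2 first.
- by move=> x _; rewrite lee_fin sqr_ge0.
- by move=> x _; rewrite lee_fin sqr_ge0.
rewrite -ge0_integralZl_EFin//; last 2 first.
- by move=> x _; rewrite -EFinD lee_fin addr_ge0 ?sqr_ge0.
- exact: emeasurable_funD.
apply: ge0_le_integral => //.
- by move=> x _; rewrite lee_fin sqr_ge0.
- by apply: measurable_sqr; exact: measurable_funD.
- by apply: measurable_funeM; exact: emeasurable_funD.
move=> x _; rewrite -EFinD -EFinM lee_fin -subr_ge0.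
have -> : 2 * (f x ^+ 2 + g x ^+ 2) - (f x + g x) ^+ 2 = (f x - g x) ^+ 2.
  by ring.
exact: sqr_ge0.
Qed.

Lemma square_integrableD f g : square_integrable f -> square_integrable g ->
  square_integrable (fun x => f x + g x).
Proof.
move=> [mf fi] [mg gi]; split; first exact: measurable_funD.
by apply: le_lt_trans (sqintD mf mg) _; rewrite lte_mul_pinfty// lte_add_pinfty.
Qed.

Lemma square_integrableZ a f : square_integrable f ->
  square_integrable (fun x => a * f x).
Proof.
move=> [mf fi]; split; first exact: measurable_funM.
by rewrite sqintZ// lte_mul_pinfty// lee_fin sqr_ge0.
Qed.

Lemma le_square_integrable f g : measurable_fun setT f -> square_integrable g ->
  (forall x, `|f x| <= `|g x|) -> square_integrable f.
Proof.
by move=> mf [mg gi] fg; split => //; exact: le_lt_trans (le_sqint _ _ fg) gi.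
Qed.

Section closure.
Variable S : set (T -> R).
Hypothesis S_sqint : forall p, S p -> square_integrable p.
Hypothesis S_linear : forall a p q, S p -> S q -> S (fun x => a * p x + q x).
Hypothesis S0 : S (fun=> 0).

(** The closure of S in the mean square, as a set of functions rather than of
    classes: this keeps pointwise products and pointwise limits available. *)
Definition L2closure : set (T -> R) :=
  [set g : T -> R | measurable_fun setT g /\ forall e : R, 0 < e ->
    exists2 p, S p & (sqint (fun x => g x - p x)%R < e%:E)%E].

Lemma subset_L2closure p : S p -> L2closure p.
Proof.
move=> Sp; have [mp _] := S_sqint Sp; split => // e e0; exists p => //.
rewrite /sqint; under eq_integral do rewrite subrr expr0n/=.
by rewrite integral0.
Qed.

Lemma L2closure_sqint g : L2closure g -> square_integrable g.
Proof.
move=> [mg /(_ 1 ltr01)[p /S_sqint[mp pi] gp]].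
rewrite (_ : g = fun x => (g x - p x) + p x); last first.
  by apply/funext => x; rewrite subrK.
apply: square_integrableD; split => //; first exact: measurable_funB.
exact: lt_trans gp (ltry _).
Qed.

Lemma L2closure_closed g : measurable_fun setT g ->
  (forall e : R, 0 < e ->
    exists2 h, L2closure h & (sqint (fun x => g x - h x)%R < e%:E)%E) ->
  L2closure g.
Proof.
move=> mg H; split => // e e0.
have e4 : 0 < e / 4 by rewrite divr_gt0.
have [h [mh /(_ _ e4)[p Sp hp]] gh] := H _ e4.
exists p => //; have [mp _] := S_sqint Sp.
rewrite (_ : (fun x => _) = fun x => (g x - h x) + (h x - p x)); last first.
  by apply/funext => x; rewrite addrA subrK.
have mgh : measurable_fun setT (fun x => g x - h x) by exact: measurable_funB.
have mhp : measurable_fun setT (fun x => h x - p x) by exact: measurable_funB.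
apply: (le_lt_trans (sqintD mgh mhp)).
rewrite (_ : e%:E = 2%:E * ((e/4)%:E + (e/4)%:E))%E; last first.
  by rewrite -EFinD -EFinM; congr EFin; field.
by rewrite lte_pmul2l// lteD.
Qed.

Lemma L2closure_linear a g h : L2closure g -> L2closure h ->
  L2closure (fun x => a * g x + h x).
Proof.
move=> [mg Vg] [mh Vh]; split.
  by apply: measurable_funD => //; exact: measurable_funM.
(* With this c the error of g contributes 2 * a ^+ 2 * (e / c) < e / 2. *)
move=> e e0; pose c := 4 * (a ^+ 2 + 1).
have c0 : 0 < c by rewrite mulr_gt0// ltr_wpDl// sqr_ge0.
have e0' : 0 < e / c by rewrite divr_gt0.
have e4 : 0 < e / 4 by rewrite divr_gt0.
have [p Sp gp] := Vg _ e0'; have [q Sq hq] := Vh _ e4.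
have [[mp _] [mq _]] := (S_sqint Sp, S_sqint Sq).
exists (fun x => a * p x + q x); first exact: S_linear.
rewrite (_ : (fun x => _) = fun x => a * (g x - p x) + (h x - q x)); last first.
  by apply/funext => x; ring.
have mgp : measurable_fun setT (fun x => g x - p x) by exact: measurable_funB.
have mhq : measurable_fun setT (fun x => h x - q x) by exact: measurable_funB.
have magp : measurable_fun setT (fun x => a * (g x - p x)).
  exact: measurable_funM.
apply: (le_lt_trans (sqintD magp mhq)); rewrite sqintZ//.
apply: (@le_lt_trans _ _ (2%:E * ((a^+2)%:E * (e/c)%:E
    + sqint (fun x => h x - q x)%R)))%E.
  rewrite lee_pmul2l// leeD2r// lee_wpmul2l ?lee_fin ?sqr_ge0//; exact: ltW.
apply: (@lt_le_trans _ _ (2%:E * ((a^+2)%:E * (e/c)%:E + (e / 4)%:E)))%E.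
  by rewrite lte_pmul2l// -EFinM lteD2lE.
rewrite -(EFinM (a ^+ 2)) -EFinD -EFinM lee_fin -subr_ge0.
have -> : e - 2 * (a ^+ 2 * (e / c) + e / 4) = e / (2 * (a ^+ 2 + 1)).
  rewrite /c; field; rewrite gt_eqF// ltr_wpDl// ?sqr_ge0//.
by rewrite divr_ge0// ?ltW// mulr_gt0// ltr_wpDl// sqr_ge0.
Qed.

Lemma L2closure0 : L2closure (fun=> 0).
Proof. exact: subset_L2closure. Qed.

(** The squared distances to the limit tend to 0 pointwise and are dominated
    by 4 * G ^+ 2, so that dominated convergence applies to them. *)
Lemma L2closure_dominated (u : nat -> T -> R) g G :
  (forall n, L2closure (u n)) -> square_integrable G ->
  (forall x, u ^~ x @ \oo --> g x) -> (forall n x, `|u n x| <= G x) ->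
  L2closure g.
Proof.
move=> Vu [mG Gi] ug uG; have mu_ n : measurable_fun setT (u n) by case: (Vu n).
have mg : measurable_fun setT g.
  by apply: (measurable_fun_cvg mu_) => x _; exact: ug.
have gG x : `|g x| <= G x.
  have ugn : `|u n x| @[n --> \oo] --> `|g x| by apply: cvg_norm; exact: ug.
  rewrite -(cvg_lim _ ugn)//; apply: limr_le.
    by apply/cvg_ex; exists `|g x|.
  by apply: nearW => n; exact: uG.
apply: L2closure_closed => // e e0.
have G0 x : 0 <= G x by exact: le_trans (normr_ge0 _) (gG x).
pose D n x := ((g x - u n x) ^+ 2)%:E : \bar R.
have mD n : measurable_fun setT (D n).
  by apply: measurable_sqr; exact: measurable_funB.
have D0 : {ae mu, forall x, setT x -> D ^~ x @ \oo --> cst 0%E x}.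
  apply: aeW => x _; apply: cvg_EFin; first exact: nearW.
  have gu : g x - u n x @[n --> \oo] --> (0 : R).
    rewrite -[X in _ --> X](subrr (g x)).
    by apply: cvgB; [exact: cvg_cst|exact: ug].
  rewrite -[X in _ --> X](mulr0 (0 : R)) (_ : _ \o _ =
    fun n => (g x - u n x) * (g x - u n x)); first exact: cvgM.
  by apply/funext => n; rewrite /D /= expr2.
have DG : {ae mu, forall x n, setT x -> (`|D n x| <= ((2 * G x) ^+ 2)%:E)%E}.
  apply: aeW => x n _; rewrite /D /= lee_fin ger0_norm ?sqr_ge0//.
  rewrite -(real_normK (num_real (_ - _))) lerXn2r ?nnegrE ?mulr_ge0//.
  rewrite (le_trans (ler_normB _ _))// mulr2n mulrDl mul1r.
  by rewrite lerD.
have [m2G i2G] := square_integrableZ 2 (conj mG Gi).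
have iG : mu.-integrable setT (fun x => ((2 * G x) ^+ 2)%:E).
  apply/integrableP; split; first exact: measurable_sqr.
  by under eq_integral do rewrite gee0_abs ?lee_fin ?sqr_ge0//.
have [_ _] := dominated_convergence measurableT mD (measurable_cst _) D0 iG DG.
rewrite /= integral0 => /fine_cvgP[finD /cvgrPdist_lt/(_ _ e0)[n0 _ Dn0]].
case: finD => n1 _ Dn1; exists (u (maxn n0 n1)) => //.
have := Dn0 (maxn n0 n1) (leq_maxl _ _).
rewrite /= sub0r normrN => /(le_lt_trans (ler_norm _)).
rewrite -lte_fin fineK//.
exact: Dn1 (leq_maxr _ _).
Qed.

End closure.
End square_integral.

(** * Bounded multipliers of a closure *)

Section multipliers.
Context d (T : measurableType d) (R : realType).
Variables (mu : {measure set T -> \bar R}) (S : set (T -> R)).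
Hypothesis S_sqint : forall p, S p -> square_integrable mu p.
Hypothesis S_linear : forall a p q, S p -> S q -> S (fun x => a * p x + q x).
Hypothesis S0 : S (fun=> 0).
Local Notation V := (L2closure mu S).
Implicit Types f g h : T -> R.

(** Multiplication by such an h preserves the closure V of S. Boundedness
    makes this an algebra which is also closed under bounded pointwise limits,
    so it behaves like a functional calculus. *)
Definition L2multiplier h :=
  [/\ measurable_fun setT h, (exists M, forall x, `|h x| <= M)
    & forall v, V v -> V (fun x => h x * v x)].

Lemma L2multiplier_cst c : L2multiplier (fun=> c).
Proof.
split => [||v Vv]; [exact: measurable_cst|by exists `|c| |].
rewrite (_ : (fun x => _) = fun x => c * v x + 0).
  by apply: L2closure_linear => //; exact: L2closure0.
by apply/funext => x; rewrite addr0.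
Qed.

Lemma L2multiplierM g h : L2multiplier g -> L2multiplier h ->
  L2multiplier (fun x => g x * h x).
Proof.
move=> [mg [M gM] Vg] [mh [M' hM'] Vh]; split; first exact: measurable_funM.
  by exists (M * M') => x; rewrite normrM ler_pM.
move=> v Vv; rewrite (_ : (fun x => _) = fun x => g x * (h x * v x)).
  exact/Vg/Vh.
by apply/funext => x; rewrite mulrA.
Qed.

Lemma L2multiplierD g h : L2multiplier g -> L2multiplier h ->
  L2multiplier (fun x => g x + h x).
Proof.
move=> [mg [M gM] Vg] [mh [M' hM'] Vh]; split; first exact: measurable_funD.
  by exists (M + M') => x; rewrite (le_trans (ler_normD _ _))// lerD.
move=> v Vv; rewrite (_ : (fun x => _) = fun x => 1 * (g x * v x) + h x * v x).
  by apply: L2closure_linear => //; [exact: Vg|exact: Vh].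
by apply/funext => x; rewrite mul1r mulrDl.
Qed.

Lemma L2multiplier_cvg (u : nat -> T -> R) h M :
  (forall n, L2multiplier (u n)) -> (forall n x, `|u n x| <= M) ->
  (forall x, u ^~ x @ \oo --> h x) -> L2multiplier h.
Proof.
move=> Bu uM uh; have mu_ n : measurable_fun setT (u n) by case: (Bu n).
split.
- by apply: (measurable_fun_cvg mu_) => x _; exact: uh.
- exists M => x; have uhn : `|u n x| @[n --> \oo] --> `|h x|.
    by apply: cvg_norm; exact: uh.
  rewrite -(cvg_lim _ uhn)//; apply: limr_le.
    by apply/cvg_ex; exists `|h x|.
  by apply: nearW => n; exact: uM.
move=> v Vv; have vi := L2closure_sqint S_sqint Vv.
apply: (@L2closure_dominated _ _ _ _ _ S_sqint (fun n x => u n x * v x) _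
  (fun x => M * `|v x|)).
- by move=> n; case: (Bu n) => _ _; exact.
- apply: square_integrableZ; apply: (le_square_integrable _ vi).
    by apply: measurableT_comp => //; case: vi.
  by move=> x; rewrite normr_id.
- by move=> x; apply: cvgM; [exact: uh|exact: cvg_cst].
- by move=> n x; rewrite normrM ler_wpM2r.
Qed.

(** Multiplication by a bounded function is continuous in the mean square, so
    it is enough to multiply the elements of S, which are dense in V. *)
Lemma L2multiplier_subset h M : measurable_fun setT h ->
  (forall x, `|h x| <= M) -> (forall p, S p -> V (fun x => h x * p x)) ->
  L2multiplier h.
Proof.
move=> mh hM Vh; split => //; first by exists M.
move=> v Vv; have [mv Hv] := Vv.
apply: L2closure_closed => //; first exact: measurable_funM.
move=> e e0.
(* The + 1 covers the case M = 0. *)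
have e0' : 0 < e / (M ^+ 2 + 1).
  by rewrite divr_gt0// ltr_wpDl// sqr_ge0.
have [p Sp vp] := Hv _ e0'; have [mp _] := S_sqint Sp.
exists (fun x => h x * p x); first exact: Vh.
have mvp : measurable_fun setT (fun x => v x - p x) by exact: measurable_funB.
apply: (@le_lt_trans _ _ (sqint mu (fun x => M * (v x - p x)))).
  apply: le_sqint; [|exact: measurable_funM|].
    by apply: measurable_funB; exact: measurable_funM.
  move=> x; rewrite -mulrBr !normrM ler_wpM2r//.
  exact: le_trans (hM x) (ler_norm _).
rewrite sqintZ//.
apply: (@le_lt_trans _ _ ((M ^+ 2)%:E * (e / (M ^+ 2 + 1))%:E)%E).
  by rewrite lee_wpmul2l ?lee_fin ?sqr_ge0//; exact: ltW.
rewrite -EFinM lte_fin mulrA ltr_pdivrMr ?ltr_wpDl ?sqr_ge0//.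
by rewrite [e * _]mulrC mulrDl mul1r ltrDl.
Qed.

(** Multipliers are stable under polynomials and bounded pointwise limits, and
    the sign is such a limit of polynomials. *)
Lemma L2multiplier_sg h : L2multiplier h -> (forall x, `|h x| <= 1) ->
  L2multiplier (fun x => Num.sg (h x)).
Proof.
move=> Bh h1.
apply: (@L2multiplier_cvg (fun n x => iter n sign_step (h x)) _ 1).
- elim=> [//|n Bn] /=.
  rewrite /sign_step (_ : (fun x => _) = fun x => iter n sign_step (h x) *
    (3 / 2 + - (1 / 2) * (iter n sign_step (h x) * iter n sign_step (h x)))).
    apply: L2multiplierM => //; apply: L2multiplierD.
      exact: L2multiplier_cst.
    by apply: L2multiplierM; [exact: L2multiplier_cst|exact: L2multiplierM].
  by apply/funext => x; field.
- by move=> n x; exact: iter_sign_step_norm.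
- by move=> x; exact: cvg_iter_sign_step.
Qed.

(** These sets form a sigma-algebra, and this is how the closure V is seen to
    contain all simple functions. *)
Definition multiplier_set : set (set T) :=
  [set E | measurable E /\ L2multiplier (\1_E : T -> R)].

Lemma multiplier_setC E : multiplier_set E -> multiplier_set (~` E).
Proof.
move=> [mE BE]; split; first exact: measurableC.
rewrite (_ : \1_(~` E) = fun x => 1 + (-1) * (\1_E : T -> R) x).
  apply: L2multiplierD; first exact: L2multiplier_cst.
  by apply: L2multiplierM => //; exact: L2multiplier_cst.
apply/funext => x; rewrite /= !indicE in_setC.
by case: (x \in E) => /=; rewrite ?mulr0 ?addr0 ?mulr1 ?subrr.
Qed.

Lemma multiplier_setI E F : multiplier_set E -> multiplier_set F ->
  multiplier_set (E `&` F).
Proof.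
move=> [mE BE] [mF BF]; split; first exact: measurableI.
by rewrite indicI; exact: L2multiplierM.
Qed.

Lemma multiplier_setU E F : multiplier_set E -> multiplier_set F ->
  multiplier_set (E `|` F).
Proof.
move=> GE GF; rewrite -(setCK (E `|` F)) setCU; apply: multiplier_setC.
by apply: multiplier_setI; exact: multiplier_setC.
Qed.

Lemma multiplier_set0 : multiplier_set set0.
Proof. by split => //; rewrite indic0; exact: L2multiplier_cst. Qed.

Lemma multiplier_set_limit (E : nat -> set T) F :
  (forall n, multiplier_set (E n)) ->
  (forall x, (\1_(E n) x : R) @[n --> \oo] --> (\1_F x : R)) ->
  measurable F -> multiplier_set F.
Proof.
move=> GE EF mF; split => //.
apply: (@L2multiplier_cvg (fun n => \1_(E n)) _ 1) => //.
  by move=> n; case: (GE n).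
by move=> n x; rewrite indicE ger0_norm//; case: (_ \in _).
Qed.

Lemma sigma_algebra_multiplier_set : sigma_algebra setT multiplier_set.
Proof.
split; first exact: multiplier_set0.
  by move=> E GE; rewrite setTD; exact: multiplier_setC.
move=> E GE; apply: (@multiplier_set_limit (fun n => \bigcup_(i < n) E i)).
- elim=> [|n IH].
    by rewrite bigcup_mkord big_ord0; exact: multiplier_set0.
  rewrite bigcup_mkord big_ord_recr/= -bigcup_mkord.
  exact: multiplier_setU.
- move=> x; have [[k _ Ekx]|nEx] := pselect ((\bigcup_i E i) x).
    rewrite indicE mem_set; last by exists k.
    apply: cvg_near_cst; exists k.+1 => // n /= kn.
    by rewrite indicE mem_set//; exists k.
  rewrite indicE memNset//; apply: cvg_near_cst; apply: nearW => n.
  by rewrite indicE memNset// => -[k _ Ekx]; apply: nEx; exists k.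
- by apply: bigcup_measurable => n _; case: (GE n).
Qed.

Import HBNNSimple.

(** When every measurable set is a multiplier set and V contains 1, the
    closure V contains the indicators, hence the simple functions, hence by
    dominated convergence every nonnegative square-integrable function. *)
Lemma L2closure_full : V (fun=> 1) ->
  (forall E, measurable E -> multiplier_set E) ->
  forall g, square_integrable mu g -> V g.
Proof.
move=> V1 GT; have Vsfun (p : {nnsfun T >-> R}) : V p.
  have -> : (p : T -> R) = fun x =>
      \sum_(y <- finmap.enum_fset (fset_set (range p)))
        y * \1_(p @^-1` [set y]) x.
    by apply/funext => x; rewrite fimfunE fsbig_finite.
  elim: (finmap.enum_fset _) => [|y s IH].
    by under eq_fun do rewrite big_nil; exact: L2closure0.
  under eq_fun do rewrite big_cons.
  apply: L2closure_linear => //.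
  have [//|_ [_ _ /(_ _ V1)]] := GT (p @^-1` [set y]).
  by under eq_fun do rewrite mulr1.
have Vpos g : (forall x, 0 <= g x) -> square_integrable mu g -> V g.
  move=> g0 gi; have [mg _] := gi.
  have mg' : measurable_fun setT (EFin \o g) by exact/measurable_EFinP.
  pose u := nnsfun_approx measurableT mg'.
  have ug x : u ^~ x @ \oo --> g x.
    have g0' y : [set: T] y -> (0 <= (EFin \o g) y)%E by rewrite lee_fin.
    by have /fine_cvgP[] := cvg_nnsfun_approx measurableT mg' g0' (I : setT x).
  apply: (@L2closure_dominated _ _ _ _ _ S_sqint u g g) => // n x.
  rewrite ger0_norm// -(cvg_lim _ (ug x))//.
  apply: nondecreasing_cvgn_le; last by apply/cvg_ex; exists (g x).
  by move=> a b ab; exact/lefP/nd_nnsfun_approx.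
move=> g gi; have [mg _] := gi.
rewrite (_ : g = fun x => (-1) * Num.max (- g x) 0 + Num.max (g x) 0).
  apply: L2closure_linear => //; apply: Vpos.
  - by move=> x; rewrite le_max lexx orbT.
  - apply: (le_square_integrable _ gi).
      by apply: measurable_maxr => //; exact: measurableT_comp.
    move=> x; case: (leP 0 (g x)) => g0.
      by rewrite max_r ?normr0// oppr_le0.
    by rewrite max_l ?normrN// oppr_ge0 ltW.
  - by move=> x; rewrite le_max lexx orbT.
  - apply: (le_square_integrable _ gi); first exact: measurable_maxr.
    by move=> x; case: (leP 0 (g x)) => g0; rewrite ?normr0.
apply/funext => x; case: (leP 0 (g x)) => g0.
  by rewrite max_r ?oppr_le0// mulr0 add0r.
by rewrite max_l ?oppr_ge0 ?ltW// mulN1r opprK addr0.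
Qed.

End multipliers.

(** * Algebras with exponentially integrable elements *)

Section sin_series.
Context {R : realType}.
Implicit Types y : R.

Lemma cvg_series_sin y : series (sin_coeff y) @ \oo --> sin y.
Proof. by rewrite unlock; exact: is_cvg_series_sin_coeff. Qed.

(** Taylor polynomials of the sine are dominated by an exponential uniformly
    in their degree. This is what exponential integrability is matched
    against. *)
Lemma norm_series_sin_le n y : `|series (sin_coeff y) n| <= expR `|y|.
Proof.
apply: (@le_trans _ _ (series (exp_coeff `|y|) n)).
  rewrite /series/=; apply: le_trans (ler_norm_sum _ _ _) _.
  apply: ler_sum => i _; rewrite /sin_coeff /exp_coeff /=.
  rewrite !normrM normfV normrX normrX normrN1 expr1n mulr1 !normr_nat.
  rewrite ler_wpM2r ?invr_ge0// ler_piMl ?exprn_ge0//.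
  by case: (odd i).
rewrite /expR; apply: nondecreasing_cvgn_le; last first.
  exact: is_cvg_series_exp_coeff.
by apply: nondecreasing_series => i _ _; exact: exp_coeff_ge0.
Qed.

(** The sine has the sign of its argument on ]-pi, pi[, and 2 is below pi. *)
Lemma sg_sin y : `|y| < 2 -> Num.sg (sin y) = Num.sg y.
Proof.
have pos (z : R) : 0 < z -> z < 2 -> 0 < sin z.
  by move=> z0 z2; apply: sin_gt0_pi; rewrite z0 (lt_le_trans z2)// pi_ge2.
case: (sgrP y) => [->|y0 y2|y0 y2]; first by rewrite sin0 sgr0.
- by rewrite gtr0_sg// pos.
- by rewrite ltr0_sg// -oppr_gt0 -sinN pos// oppr_gt0.
Qed.

End sin_series.

Section exponentially_integrable_algebra.
Context d (T : measurableType d) (R : realType).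
Variables (mu : {measure set T -> \bar R}) (S : set (T -> R)).
Hypothesis S_sqint : forall p, S p -> square_integrable mu p.
Hypothesis S_cst : forall c, S (fun=> c).
Hypothesis S_D : forall p q, S p -> S q -> S (fun x => p x + q x).
Hypothesis S_M : forall p q, S p -> S q -> S (fun x => p x * q x).
Local Notation V := (L2closure mu S).

Let S_linear a p q : S p -> S q -> S (fun x => a * p x + q x).
Proof. by move=> Sp Sq; apply: S_D => //; apply: S_M. Qed.

(** The tail of such a q is so light that, for small s, the power series of
    sin (s q) converges in the mean square. *)
Definition exp_integrable (q : T -> R) :=
  exists2 delta : R, 0 < delta &
    (\int[mu]_x (expR (delta * `|q x|))%:E < +oo)%E.

Lemma algebra_sin_series q n s :
  S q -> S (fun x => series (sin_coeff (s * q x)) n).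
Proof.
move=> Sq; rewrite /series/=; elim: n => [|n IH].
  by under eq_fun do rewrite big_geq//.
under eq_fun do rewrite big_nat_recr//=; apply: S_D => //.
apply: (S_M _ (S_cst _)); apply: S_M; first exact: S_cst.
elim: n {IH} => [|n IH]; first by under eq_fun do rewrite expr0.
by under eq_fun do rewrite exprS; apply: S_M => //; apply: S_M.
Qed.

(** The factor 4 leaves room for p: by the inequality of arithmetic and
    geometric means, the square of p * exp (s * q) is at most p ^ 4 + exp (4 *
    s * q), up to absolute values, and p ^ 4 is the square of the element p *
    p of S. *)
Lemma square_integrable_mul_exp p q delta s : S p -> S q ->
  (\int[mu]_x (expR (delta * `|q x|))%:E < +oo)%E -> 4 * s <= delta ->
  square_integrable mu (fun x => `|p x| * expR (s * `|q x|)).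
Proof.
move=> Sp Sq qi sd; have [mp _] := S_sqint Sp; have [mq _] := S_sqint Sq.
have mabs (f : T -> R) : measurable_fun setT f ->
  measurable_fun setT (fun x => `|f x|) by move=> mf; exact: measurableT_comp.
have mexp a : measurable_fun setT (fun x => expR (a * `|q x|)).
  by apply: measurableT_comp => //; apply: measurable_funM => //; exact: mabs.
split; first by apply: measurable_funM => //; exact: mabs.
have [mp2 p4] := S_sqint (S_M Sp Sp).
apply: (@le_lt_trans _ _
  (\int[mu]_x (((p x * p x) ^+ 2)%:E + (expR (delta * `|q x|))%:E))%E).
  apply: ge0_le_integral => //.
  - by apply: measurable_sqr; apply: measurable_funM => //; exact: mabs.
  - apply: emeasurable_funD; first exact: measurable_sqr.
    exact/measurable_EFinP.
  move=> x _; rewrite -EFinD lee_fin.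
  have e4 : expR (s * `|q x|) ^+ 4 <= expR (delta * `|q x|).
    by rewrite -expRM_natl ler_expR mulrA ler_wpM2r.
  apply: (le_trans _ (lerD (lexx _) e4)); set E := expR _.
  rewrite exprMn real_normK ?num_real// -subr_ge0.
  have -> : (p x * p x) ^+ 2 + E ^+ 4 - p x ^+ 2 * E ^+ 2 =
    ((p x ^+ 2 - E ^+ 2) ^+ 2 + (p x ^+ 2) ^+ 2 + (E ^+ 2) ^+ 2) / 2 by field.
  by rewrite divr_ge0// !addr_ge0// sqr_ge0.
rewrite ge0_integralD//.
- exact: lte_add_pinfty.
- by move=> x _; rewrite lee_fin sqr_ge0.
- exact: measurable_sqr.
- exact/measurable_EFinP.
Qed.

(** For p in S, sin (s * q) * p is the pointwise limit of the products of p by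
    Taylor polynomials in q, which belong to S and are dominated by the
    square-integrable function |p| * exp (s * |q|). *)
Lemma L2multiplier_sin q delta s : S q ->
  (\int[mu]_x (expR (delta * `|q x|))%:E < +oo)%E ->
  0 <= s -> 4 * s <= delta -> L2multiplier mu S (fun x => sin (s * q x)).
Proof.
move=> Sq qi s0 sd; have [mq _] := S_sqint Sq.
apply: (L2multiplier_subset S_sqint (M := 1)).
- apply: measurableT_comp.
    by apply: continuous_measurable_fun => x; exact: continuous_sin.
  exact: measurable_funM.
- by move=> x; rewrite ler_norml sin_geN1 sin_le1.
move=> p Sp; apply: (L2closure_dominated S_sqint
    (u := fun n x => series (sin_coeff (s * q x)) n * p x)
    (G := fun x => `|p x| * expR (s * `|q x|))).
- move=> n; apply: (subset_L2closure S_sqint); apply: S_M => //.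
  exact: algebra_sin_series.
- exact: (@square_integrable_mul_exp _ _ delta).
- by move=> x; apply: cvgM; [exact: cvg_series_sin|exact: cvg_cst].
- move=> n x; rewrite normrM mulrC ler_wpM2l//.
  by rewrite (le_trans (norm_series_sin_le _ _))// normrM (ger0_norm s0).
Qed.

(** Only sin (s * q) with small s is a multiplier to begin with, and it
    forgets q modulo the period. Letting s tend to 0 recovers the sign of q:
    at a given point, s * q is eventually in ]-2, 2[, where the sine has the
    sign of its argument. *)
Lemma multiplier_set_gt0 q : S q -> exp_integrable q ->
  multiplier_set mu S [set x | 0 < q x].
Proof.
move=> Sq [delta d0 qi]; have [mq _] := S_sqint Sq.
pose s k : R := delta / 4 / k.+1%:R.
have s_ge0 k : 0 < s k by rewrite !divr_gt0.
have s_le k : 4 * s k <= delta.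
  rewrite /s mulrA [4 * _]mulrC divfK// ler_pdivrMr//.
  by apply: ler_peMr; [exact: ltW|rewrite ler1n].
have Bsg : L2multiplier mu S (fun x => Num.sg (q x)).
  apply: (L2multiplier_cvg S_sqint (M := 1)
    (u := fun k x => Num.sg (sin (s k * q x)))).
  - move=> k; apply: (L2multiplier_sg S_sqint S_linear) => //.
      by apply: (L2multiplier_sin Sq qi) => //; exact: ltW.
    by move=> x; rewrite ler_norml sin_geN1 sin_le1.
  - by move=> k x; rewrite normr_sg; case: (_ != 0).
  move=> x; apply: cvg_near_cst.
  have : s k * `|q x| @[k --> \oo] --> (0 : R).
    rewrite -(mul0r `|q x|); apply: cvgM; last exact: cvg_cst.
    rewrite -(mulr0 (delta / 4)); apply: cvgM; first exact: cvg_cst.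
    exact: cvg_harmonic.
  move=> /cvgrPdist_lt/(_ 2)/(_ ltac:(by []))[n _ H]; exists n => // k /H.
  rewrite /= sub0r normrN normrM normr_id -normrM => /sg_sin ->.
  by rewrite sgrM gtr0_sg// mul1r.
split.
  rewrite (_ : [set x | _] = setT `&` q @^-1` `]0, +oo[%classic).
    exact: mq.
  by apply/seteqP; split => x /=; rewrite in_itv/= andbT; [|case].
rewrite (_ : \1_ _ = fun x =>
  1 / 2 * (Num.sg (q x) + Num.sg (q x) * Num.sg (q x))).
  apply: L2multiplierM; first exact: L2multiplier_cst.
  apply: (L2multiplierD S_sqint S_linear) => //; exact: L2multiplierM.
apply/funext => x; rewrite indicE; case: (sgrP (q x)) => [q0|q0|q0].
- by rewrite memNset/= ?q0 ?ltxx// mul0r addr0 mulr0.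
- by rewrite mem_set//=; field.
- by rewrite memNset/=; [field|apply/negP; rewrite -leNgt ltW].
Qed.

(** A density criterion without duality: the closure is not described through
    its orthogonal complement; it is saturated by multipliers until it
    contains all simple functions. *)
Theorem L2closure_exp_integrable :
  (forall E, measurable E ->
    <<s [set [set x | 0 < q x] |
         q in [set q | S q /\ exp_integrable q]] >> E) ->
  forall g, square_integrable mu g -> V g.
Proof.
move=> GE; apply: (L2closure_full S_sqint S_linear) => //.
  exact: subset_L2closure.
move=> E /GE; apply; split.
  exact: sigma_algebra_multiplier_set.
by move=> _ [q [Sq qe] <-]; exact: multiplier_set_gt0.
Qed.

End exponentially_integrable_algebra.

(** * Densities and norms on R^n *)

Section integral_density.
Context d (T : measurableType d) (R : realType).
Variables (lam nu : {measure set T -> \bar R}) (A : set T) (f : T -> R).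
Hypothesis mA : measurable A.
Hypothesis mf : measurable_fun setT f.
Hypothesis f0 : forall x, 0 <= f x.
Hypothesis nuE : forall B, measurable B ->
  nu B = (\int[lam]_(x in B `&` A) (f x)%:E)%E.
Import HBNNSimple.
Local Open Scope ereal_scope.

Let integral_density_nnsfun (u : {nnsfun T >-> R}) :
  \int[nu]_x (u x)%:E = \int[lam]_(x in A) (u x * f x)%:E.
Proof.
have mfE : measurable_fun A (EFin \o f).
  by apply/measurable_EFinP; exact: measurable_funTS.
rewrite integralT_nnsfun sintegralE.
transitivity (\int[lam]_(x in A) (\sum_(y \in range u)
    (y%:E * ((f x)%:E * (\1_(u @^-1` [set y]) x)%:E)))).
  rewrite ge0_integral_fsum//; last 2 first.
  - move=> y; apply: emeasurable_funM => //; apply: emeasurable_funM => //.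
    by apply/measurable_EFinP.
  - move=> y x Ax.
    have [[z _ zy]|/(preimage10 (f := u)) ->] := pselect (range u y).
      by rewrite -zy !mule_ge0 ?lee_fin.
    by rewrite indic0 !mule0.
  apply: eq_fsbigr => y; rewrite inE => -[t _ ty].
  rewrite ge0_integralZl//; last 3 first.
  - by apply: emeasurable_funM => //; apply/measurable_EFinP.
  - by move=> x Ax; rewrite mule_ge0 ?lee_fin.
  - by rewrite -ty lee_fin.
  congr (_ * _); rewrite nuE// setIC integral_mkcondr.
  by apply: eq_integral => x xA; rewrite epatch_indic.
apply: eq_integral => x xA.
transitivity ((f x)%:E * \sum_(y \in range u) (y * \1_(u @^-1` [set y]) x)%:E).
  rewrite ge0_mule_fsumr; last by move=> y; exact: nnfun_muleindic_ge0.
  by apply: eq_fsbigr => y _; rewrite muleCA EFinM.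
by rewrite fsumEFin// -fimfunE -EFinM mulrC.
Qed.

(** For a simple function this is the defining property of nu, and both sides
    pass to the limit along an increasing sequence of simple functions. *)
Lemma ge0_integral_density (g : T -> R) :
  measurable_fun setT g -> (forall x, 0 <= g x)%R ->
  \int[nu]_x (g x)%:E = \int[lam]_(x in A) (g x * f x)%:E.
Proof.
move=> mg g0; have mgE : measurable_fun setT (EFin \o g).
  exact/measurable_EFinP.
pose u := nnsfun_approx measurableT mgE.
have ug x : (EFin \o u ^~ x) n @[n --> \oo] --> (g x)%:E.
  by apply: cvg_nnsfun_approx => // y _; rewrite lee_fin.
have ndu x a b : (a <= b)%N -> (u a x <= u b x)%R.
  by move=> ab; exact/lefP/nd_nnsfun_approx.
have mfA : measurable_fun A f by exact: measurable_funTS.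
transitivity (limn (fun n => \int[nu]_x (u n x)%:E)).
  rewrite -monotone_convergence//.
  - by apply: eq_integral => x _; apply/esym/cvg_lim => //; exact: ug.
  - by move=> n; exact/measurable_EFinP.
  - by move=> n x _; rewrite lee_fin.
  - by move=> x _ a b ab; rewrite lee_fin ndu.
under eq_fun do rewrite integral_density_nnsfun.
rewrite -monotone_convergence//.
- apply: eq_integral => x _; apply/cvg_lim => //.
  under eq_fun do rewrite EFinM; rewrite EFinM.
  by apply: cvgeZr => //; exact: ug.
- move=> n; apply/measurable_EFinP; apply: measurable_funM => //.
  exact: measurable_funTS.
- by move=> n x _; rewrite lee_fin mulr_ge0.
- by move=> x _ a b ab; rewrite lee_fin ler_wpM2r// ndu.
Qed.

End integral_density.

Lemma rV_coord_le_norm (R : realType) n (x : 'rV[R]_n) i : `|x ord0 i| <= `|x|.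
Proof.
rewrite [leRHS]/Num.Def.normr /= mx_normrE.
exact: (le_bigmax_cond _ (fun j : 'I_1 * 'I_n => `|x j.1 j.2|)
  (j := (ord0, i))).
Qed.

Section norm_equivalence.
Context {R : realType} {N : nat}.
Variable nrm : 'rV[R]_N -> R.
Hypothesis nrm_norm : is_norm nrm.

Let nrmD x y : nrm (x + y) <= nrm x + nrm y. Proof. by case: nrm_norm. Qed.
Let nrmZ a x : nrm (a *: x) = `|a| * nrm x. Proof. by case: nrm_norm. Qed.
Let nrm0_eq0 x : nrm x = 0 -> x = 0.
Proof. by case: nrm_norm => _ _; exact. Qed.

Let nrm0 : nrm 0 = 0. Proof. by rewrite -(scale0r 0) nrmZ normr0 mul0r. Qed.
Let nrmN x : nrm (- x) = nrm x.
Proof. by rewrite -scaleN1r nrmZ normrN1 mul1r. Qed.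
Let nrm_ge0 x : 0 <= nrm x.
Proof.
have := nrmD x (- x); rewrite subrr nrm0 nrmN -mulr2n => h.
by rewrite pmulrn_lge0 in h.
Qed.

(** By the triangle inequality on the expansion in the canonical basis, the
    norm is Lipschitz for the supremum norm. *)
Lemma is_norm_continuous : continuous nrm.
Proof.
pose M := \sum_i nrm (delta_mx ord0 i).
have M0 : 0 <= M by apply: sumr_ge0.
have nrmM x : nrm x <= M * `|x|.
  rewrite [X in nrm X]row_sum_delta.
  apply: (@le_trans _ _ (\sum_i nrm (x ord0 i *: delta_mx ord0 i))).
    elim/big_ind2 : _ => [|a b a' b' ha hb|//]; first by rewrite nrm0.
    by rewrite (le_trans (nrmD _ _))// lerD.
  rewrite /M mulr_suml; apply: ler_sum => i _; rewrite nrmZ mulrC ler_wpM2l//.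
  exact: rV_coord_le_norm.
move=> x; apply/(@cvgrPdist_lt _ _ _ (nbhs x) _ nrm (nrm x)) => e e0.
have M1 : 0 < M + 1 by rewrite ltr_wpDl.
have dist y : `|nrm x - nrm y| <= M * `|x - y|.
  apply: (le_trans _ (nrmM (x - y))); rewrite ler_norml lerNl opprB !lerBlDr.
  have := nrmD (x - y) y; rewrite subrK => ->.
  by have := nrmD (y - x) x; rewrite subrK -(nrmN (y - x)) opprB => ->.
have e'0 : 0 < e / (M + 1) by rewrite divr_gt0.
have xe' := @cvgr_dist_lt _ _ _ (nbhs x) (nbhs_filter x) id x cvg_id _ e'0.
apply: filterS xe' => y /= xy; apply: (le_lt_trans (dist y)).
apply: (@le_lt_trans _ _ ((M + 1) * `|x - y|)).
  by rewrite ler_wpM2r// lerDl.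
by rewrite mulrC -ltr_pdivlMr.
Qed.

Lemma measurable_is_norm : measurable_fun setT nrm.
Proof.
apply: (measurability _ (RGenOInfty.measurableE R)) => _ [_ [a ->] <-].
rewrite setTI; apply: measurable_open_rV.
apply: open_comp; last exact: interval_open.
by move=> x _; exact: is_norm_continuous.
Qed.

(** A norm attains a positive minimum on the unit sphere of the supremum norm,
    which is compact; the inverse of this minimum is the constant. *)
Lemma coord_le_norm : exists2 C : R, 0 < C &
  forall (x : 'rV[R]_N) i, `|x ord0 i| <= C * nrm x.
Proof.
pose sph := [set x : 'rV[R]_N | `|x| = 1].
have [[x0 sx0]|nosph] := pselect (sph !=set0); last first.
  exists 1 => // x i; have [->|xn0] := eqVneq x 0.
    by rewrite mxE normr0 nrm0 mulr0.
  case: nosph; exists (`|x|^-1 *: x); rewrite /sph/=.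
  by rewrite normrZ normfV normr_id mulVf// normr_eq0.
have csph : compact sph.
  apply: bounded_closed_compact.
    by exists 1; split => // M M1 x /= ->; exact: ltW.
  apply: (@closed_comp _ _ (fun x : 'rV[R]_N => `|x|) [set 1]).
    by move=> x _; exact: norm_continuous.
  exact: closed_eq.
have [c csph0 cmin] := EVT_min_rV (ex_intro _ x0 sx0) csph
  (continuous_subspaceT is_norm_continuous).
have c0 : 0 < nrm c.
  rewrite lt_def nrm_ge0 andbT; apply/eqP => /nrm0_eq0 c0.
  by move: csph0; rewrite inE /sph/= c0 normr0 => /esym/eqP; rewrite oner_eq0.
exists (nrm c)^-1; first by rewrite invr_gt0.
move=> x i; apply: (le_trans (rV_coord_le_norm x i)).
have [->|xn0] := eqVneq x 0; first by rewrite normr0 nrm0 mulr0.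
rewrite mulrC ler_pdivlMr//.
have := cmin (`|x|^-1 *: x); rewrite inE /sph /= normrZ normfV normr_id.
rewrite mulVf ?normr_eq0// => /(_ erefl).
by rewrite nrmZ normfV normr_id ler_pdivlMl ?normr_gt0// mulrC.
Qed.

End norm_equivalence.

(** * Polynomial functions and their moments *)

Section polynomial_functions.
Context {R : realType} {N : nat}.
Implicit Types (p q : mpoly N R) (x : 'rV[R]_N).

Lemma pevalD p q x : peval (p + q) x = peval p x + peval q x.
Proof. exact: mevalD. Qed.

Lemma pevalM p q x : peval (p * q) x = peval p x * peval q x.
Proof. exact: mevalM. Qed.

Lemma pevalZ a p x : peval (a *: p) x = a * peval p x.
Proof. exact: mevalZ. Qed.

Lemma pevalC a x : peval (mpolyC N a) x = a.
Proof. exact: mevalC. Qed.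

Lemma pevalX i x : peval (mpolyX R (mnm1 i)) x = x ord0 i.
Proof. exact: mevalXU. Qed.

Lemma pevalE p x :
  peval p x = \sum_(m <- msupp p) mcoeff m p * monomial m x.
Proof. by rewrite /peval mevalE. Qed.

Lemma measurable_monomial (j : multinom N) :
  measurable_fun setT (fun x : 'rV[R]_N => monomial j x).
Proof.
apply: measurable_prod => i _; apply: measurable_funX; exact: measurable_coord.
Qed.

Lemma measurable_peval p : measurable_fun setT (fun x => peval p x).
Proof.
under eq_fun do rewrite pevalE.
apply: measurable_sum => m; apply: measurable_funM => //.
exact: measurable_monomial.
Qed.

End polynomial_functions.

Section moments.
Context {R : realType} {N : nat}.
Variables (A : set 'rV[R]_N) (mA : measurable A) (f : {mfun 'rV[R]_N >-> R}).
Hypothesis f_ge0 : forall x, 0 <= f x.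
Hypothesis moments : forall j : multinom N,
  (\int[lebesgue_rV N]_(x in A) (`|monomial j x| * f x)%:E < +oo)%E.
Local Notation lambda := (lebesgue_rV N).
Local Notation mu := (density_on f_ge0 mA).
Implicit Types (p q r : mpoly N R).

Lemma integrable_peval r : lambda.-integrable A (fun x => (peval r x * f x)%:E).
Proof.
have mf : measurable_fun A f by exact: measurable_funTS.
apply: (eq_integrable mA (fun x =>
    \sum_(m <- msupp r) ((mcoeff m r)%:E * (monomial m x * f x)%:E)%E)).
  move=> x _; rewrite pevalE mulr_suml -sumEFin.
  by apply: eq_bigr => m _; rewrite -mulrA EFinM.
apply: integrable_sum => // m _; apply: integrableZl => //.
apply/integrableP; split.
  apply/measurable_EFinP; apply: measurable_funM => //.
  by apply: measurable_funTS; exact: measurable_monomial.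
apply: le_lt_trans (moments m); rewrite le_eqVlt; apply/orP; left; apply/eqP.
by apply: eq_integral => x _ /=; rewrite normrM (ger0_norm (f_ge0 x)).
Qed.

Lemma density_onE B : measurable B ->
  mu B = (\int[lambda]_(x in B `&` A) (f x)%:E)%E.
Proof. by []. Qed.

Lemma ge0_integral_density_on (g : 'rV[R]_N -> R) :
  measurable_fun setT g -> (forall x, 0 <= g x) ->
  (\int[mu]_x (g x)%:E = \int[lambda]_(x in A) (g x * f x)%:E)%E.
Proof.
by move=> mg g0; apply: ge0_integral_density => //; exact: density_onE.
Qed.

Lemma square_integrable_peval p : square_integrable mu (fun x => peval p x).
Proof.
split; first exact: measurable_peval.
rewrite /sqint ge0_integral_density_on; last 2 first.
- by apply: measurable_funX; exact: measurable_peval.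
- by move=> x; exact: sqr_ge0.
have /integrableP[_] := integrable_peval (p * p); apply: le_lt_trans.
rewrite le_eqVlt; apply/orP; left; apply/eqP.
apply: eq_integral => x _; rewrite gee0_abs pevalM -expr2//.
by rewrite lee_fin mulr_ge0 ?sqr_ge0.
Qed.

End moments.

(** The identity is measurable from the sigma-algebra generated by G to the
    Borel one because each of its coordinates is. *)
Lemma sub_sigma_halfspaces (R : realType) N (G : set (set 'rV[R]_N)) :
  (forall i a, G [set x | a < x ord0 i]) ->
  forall E : set 'rV[R]_N, measurable E -> <<s G >> E.
Proof.
move=> Gi E mE.
have mid : measurable_fun setT (fun x : g_sigma_algebraType G => x : 'rV[R]_N).
  apply: measurable_fun_rV => i.
  apply: (measurability _ (RGenOInfty.measurableE R)) => _ [_ [a ->] <-].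
  rewrite setTI; apply: sub_sigma_algebra.
  have := Gi i a; congr (G _).
  by apply/seteqP; split => x /=; rewrite in_itv/= andbT.
by have := mid measurableT E mE; rewrite setTI.
Qed.

(** * Exponential integrability of the coordinates *)

Lemma measurable_compact_rV (R : realType) N (K : set 'rV[R]_N) :
  compact K -> measurable K.
Proof.
move=> cK; rewrite -(setCK K); apply: measurableC; apply: measurable_open_rV.
by apply: closed_openC; exact: compact_closed.
Qed.

Section tails.
Context {R : realType} {N : nat}.
Variables (A : set 'rV[R]_N) (mA : measurable A) (f : {mfun 'rV[R]_N >-> R}).
Hypothesis f_ge0 : forall x, 0 <= f x.
Hypothesis moments : forall j : multinom N,
  (\int[lebesgue_rV N]_(x in A) (`|monomial j x| * f x)%:E < +oo)%E.
Local Notation lambda := (lebesgue_rV N).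
Local Notation mu := (density_on f_ge0 mA).
Local Notation coord i := (fun x : 'rV[R]_N => x ord0 i).

Lemma measurable_exp_norm delta (g : 'rV[R]_N -> R) : measurable_fun setT g ->
  measurable_fun setT (fun x => expR (delta * `|g x|)).
Proof.
move=> mg; apply: measurableT_comp => //; apply: measurable_funM => //.
exact: measurableT_comp.
Qed.

Lemma exp_integrable_shift i a :
  exp_integrable mu (coord i) ->
  exp_integrable mu (fun x : 'rV[R]_N => x ord0 i - a).
Proof.
move=> [delta d0 ci]; exists delta => //.
have mc : measurable_fun setT (coord i) by exact: measurable_coord.
apply: (@le_lt_trans _ _
  (\int[mu]_x ((expR (delta * `|a|))%:E * (expR (delta * `|x ord0 i|))%:E))%E).
  apply: ge0_le_integral => //.
  - apply/measurable_EFinP; apply: measurable_exp_norm.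
    by apply: measurable_funB => //.
  - apply: measurable_funeM; apply/measurable_EFinP.
    exact: measurable_exp_norm.
  move=> x _; rewrite -EFinM lee_fin -expRD ler_expR -mulrDr ler_pM2l//.
  by rewrite [leRHS]addrC; exact: ler_normB.
rewrite ge0_integralZl_EFin ?expR_ge0//.
  by rewrite lte_mul_pinfty// lee_fin expR_ge0.
by apply/measurable_EFinP; exact: measurable_exp_norm.
Qed.

Lemma exp_integrable_coord_bounded (K : set 'rV[R]_N) : compact K ->
  mu (~` K) = 0%E -> forall i, exp_integrable mu (coord i).
Proof.
move=> cK muK i; have mK := measurable_compact_rV cK.
have [M [_ KM]] := compact_bounded cK.
pose B := M + 1; have KB x : K x -> `|x ord0 i| <= B.
  move=> Kx; apply: (le_trans (rV_coord_le_norm x i)).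
  by apply: KM => //; rewrite /B ltrDl.
exists 1 => //.
apply: (@le_lt_trans _ _ (\int[mu]_x (cst (expR B)%:E x))%E); last first.
  rewrite integral_cst// lte_mul_pinfty ?lee_fin ?expR_ge0//.
  have [_] := square_integrable_peval mA f_ge0 moments 1.
  rewrite /sqint; under eq_integral do rewrite /peval meval1 expr1n.
  by rewrite integral_cst// mul1e.
apply: ae_ge0_le_integral => //.
- apply/measurable_EFinP; apply: measurable_exp_norm.
  exact: measurable_coord.
- by move=> x _; rewrite lee_fin expR_ge0.
- exists (~` K); split => //; first exact: measurableC.
  move=> x /= h Kx; apply: h => _.
  by rewrite lee_fin ler_expR mul1r KB.
Qed.

(** All norms on R^n are equivalent, so a tail condition for any of them
    controls each coordinate. *)
Lemma exp_integrable_coord_norm (nrm : 'rV[R]_N -> R) alpha :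
  is_norm nrm -> 0 < alpha ->
  (\int[lambda]_(x in A) (expR (alpha * nrm x) * f x)%:E < +oo)%E ->
  forall i, exp_integrable mu (coord i).
Proof.
move=> nn a0 ai i; have [C C0 xC] := coord_le_norm nn.
exists (alpha / C); first exact: divr_gt0.
rewrite -ge0_integral_density_on in ai; last 2 first.
- apply: measurableT_comp => //; apply: measurable_funM => //.
  exact: measurable_is_norm.
- by move=> x; exact: expR_ge0.
apply: le_lt_trans ai; apply: ge0_le_integral => //.
- apply/measurable_EFinP; apply: measurable_exp_norm.
  exact: measurable_coord.
- apply/measurable_EFinP; apply: measurableT_comp => //.
  by apply: measurable_funM => //; exact: measurable_is_norm.
- move=> x _; rewrite lee_fin ler_expR -mulrA ler_pM2l// ler_pdivrMl//.
Qed.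

(** The half-spaces a < x_i are the sets where the polynomials x_i - a are
    positive, and they generate the Borel sigma-algebra. *)
Theorem L2closure_polynomials :
  (forall i, exp_integrable mu (coord i)) ->
  forall g, square_integrable mu g -> L2closure mu (range (@peval R N)) g.
Proof.
move=> ci; apply: L2closure_exp_integrable.
- by move=> _ [p _ <-]; exact: square_integrable_peval.
- by move=> c; exists (mpolyC N c) => //; apply/funext => x; rewrite pevalC.
- move=> _ _ [p _ <-] [q _ <-]; exists (p + q) => //.
  by apply/funext => x; rewrite pevalD.
- move=> _ _ [p _ <-] [q _ <-]; exists (p * q) => //.
  by apply/funext => x; rewrite pevalM.
apply: sub_sigma_halfspaces => i a.
exists (fun x : 'rV[R]_N => x ord0 i - a); last first.
  by apply/seteqP; split => x /=; rewrite subr_gt0.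
split; last exact: exp_integrable_shift.
exists (mpolyX R (mnm1 i) + mpolyC N (- a)) => //; apply/funext => x.
by rewrite pevalD pevalX pevalC.
Qed.

End tails.

(** * Orthogonal decomposition of polynomials *)

Section linear_sets.
Context {R : pzRingType} {V : lmodType R}.
Implicit Types (W S : set V).

Definition linear_set W := W 0 /\ forall a u v, W u -> W v -> W (a *: u + v).

Lemma linear_setD W u v : linear_set W -> W u -> W v -> W (u + v).
Proof. by move=> [_ WL] Wu Wv; rewrite -(scale1r u); exact: WL. Qed.

Lemma linear_setZ W a u : linear_set W -> W u -> W (a *: u).
Proof. by move=> [W0 WL] Wu; rewrite -(addr0 (a *: u)); exact: WL. Qed.

Lemma linear_setB W u v : linear_set W -> W u -> W v -> W (u - v).
Proof. by move=> [_ WL] Wu Wv; rewrite addrC -scaleN1r; exact: WL. Qed.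

Lemma linear_set_sum W (I : Type) (s : seq I) (F : I -> V) :
  linear_set W -> (forall i, W (F i)) -> W (\sum_(i <- s) F i).
Proof.
move=> LW WF; elim: s => [|i s IH]; first by rewrite big_nil; case: LW.
by rewrite big_cons; apply: linear_setD.
Qed.

End linear_sets.

Section lspan.
Context {R : realType} {V : lmodType R}.
Implicit Types (W S : set V).

Lemma linear_lspan S : linear_set (lspan S).
Proof.
split.
  by exists 0%N, (fun=> 0), (fun=> 0); split; [case|rewrite big_ord0].
move=> a u v [n [c [s [Ss ->]]]] [m [c' [s' [Ss' ->]]]].
exists (n + m)%N,
  (fun i => match fintype.split i with inl j => a * c j | inr j => c' j end),
  (fun i => match fintype.split i with inl j => s j | inr j => s' j end); split.
  by move=> i; case: (fintype.split i).
rewrite big_split_ord/= scaler_sumr; congr (_ + _); apply: eq_bigr => i _.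
  by rewrite scalerA (unsplitK (inl i : 'I_n + 'I_m)).
by rewrite (unsplitK (inr i : 'I_n + 'I_m)).
Qed.

Lemma sub_lspan S : S `<=` lspan S.
Proof.
move=> u Su; exists 1%N, (fun=> 1), (fun=> u); split => //.
by rewrite big_ord1 scale1r.
Qed.

Lemma lspan_sub S W : linear_set W -> S `<=` W -> lspan S `<=` W.
Proof.
move=> LW SW _ [n [c [s [Ss ->]]]]; apply: linear_set_sum => // i.
by apply: linear_setZ => //; exact/SW.
Qed.

End lspan.

Section semidefinite_projection.
Context {R : realFieldType} {V : lmodType R}.
Variable B : V -> V -> R.
Hypothesis BC : forall u v, B u v = B v u.
Hypothesis BL : forall a u v w, B (a *: u + v) w = a * B u w + B v w.
Hypothesis B_ge0 : forall u, 0 <= B u u.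

Let BD u v w : B (u + v) w = B u w + B v w.
Proof. by rewrite -(scale1r u) BL mul1r scale1r. Qed.

Let B0 w : B 0 w = 0.
Proof. by apply: (addrI (B 0 w)); rewrite -BD !addr0. Qed.

Let BZ a u w : B (a *: u) w = a * B u w.
Proof. by rewrite -(addr0 (a *: u)) BL B0 addr0. Qed.

Let BB u v w : B (u - v) w = B u w - B v w.
Proof. by rewrite -scaleN1r BD BZ mulN1r. Qed.

(** If B u u = 0, the polynomial B (t u + v) (t u + v) in t is affine with
    slope 2 * B v u and nonnegative everywhere, so its slope vanishes. *)
Lemma semidefinite_null u v : B u u = 0 -> B v u = 0.
Proof.
move=> u0; have H t : 0 <= B v v + 2 * t * B v u.
  have := B_ge0 (t *: u + v); rewrite BL (BC u) (BC v) !BL u0 mulr0 add0r BC.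
  by congr (_ <= _); rewrite (BC u v); ring.
(* At this point the affine function would take the value -1. *)
have := H (- (B v v + 1) / (2 * B v u)).
have [//|n0] := eqVneq (B v u) 0.
rewrite (_ : _ + _ = -1) ?ler0N1//.
by field.
Qed.

Lemma linear_set_orthogonal (O : set V) :
  linear_set [set w | forall x, (forall y, O y -> B x y = 0) -> B x w = 0].
Proof.
split=> [x _|a u v Hu Hv x Ox]; first by rewrite BC B0.
by rewrite BC BL BC Hu// BC Hv// mulr0 addr0.
Qed.

(** The Gram-Schmidt process for a form which may be degenerate: distinct
    polynomials may coincide almost everywhere, and their difference is then a
    null vector. Such a vector is orthogonal to everything and can be skipped.
    The conclusion is about an arbitrary linear set W containing s, rather
    than the span of s, so that the induction may choose W. *)
Lemma semidefinite_projection (s : seq V) (W : set V) (v : V) :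
  linear_set W -> (forall u, u \in s -> W u) ->
  exists2 w, W w & forall u, u \in s -> B (v - w) u = 0.
Proof.
elim: s W v => [|u s IH] W v LW sW; first by exists 0 => //; case: LW.
have sW' y : y \in s -> W y by move=> ys; apply: sW; rewrite inE ys orbT.
have Wu : W u by apply: sW; rewrite mem_head.
have [wv Wwv vs] := IH W v LW sW'.
(* Vectors orthogonal to s are also orthogonal to the approximation wu of u
   because wu is taken in W'. *)
pose W' := W `&`
  [set w | forall x, (forall y, y \in s -> B x y = 0) -> B x w = 0].
have LW' : linear_set W'.
  have [Oz OL] := linear_set_orthogonal (fun y => y \in s).
  case: LW => W0 WL; split; first by split.
  by move=> a x y [Wx Ox] [Wy Oy]; split; [exact: WL|exact: OL].
have [wu [Wwu Owu] us] := IH W' u LW'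
  (fun y ys => conj (sW' y ys) (fun x Ox => Ox y ys)).
pose u' := u - wu.
have Buu x : (forall y, y \in s -> B x y = 0) -> B x u = B x u'.
  by move=> xs; rewrite BC -(subrK wu u) BD BC [B wu x]BC Owu// addr0.
have [u'0|u'n0] := eqVneq (B u' u') 0.
  exists wv => // y; rewrite inE => /predU1P[->|]; last exact: vs.
  by rewrite Buu//; exact: semidefinite_null.
pose c := B (v - wv) u' / B u' u'.
have cs y : y \in s -> B (v - (c *: u' + wv)) y = 0.
  by move=> ys; rewrite BB BL us// mulr0 add0r -BB; exact: vs.
exists (c *: u' + wv).
  by have [_ LWL] := LW; apply: LWL => //; exact: linear_setB.
move=> y; rewrite inE => /predU1P[->|]; last exact: cs.
rewrite Buu// BB BL opprD addrA addrAC -BB /c divfK// subrr//.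
Qed.

End semidefinite_projection.

Section orthogonal_sum.
Context {R : realType} {N : nat}.
Variables (A : set 'rV[R]_N) (mA : measurable A) (f : {mfun 'rV[R]_N >-> R}).
Hypothesis f_ge0 : forall x, 0 <= f x.
Hypothesis moments : forall j : multinom N,
  (\int[lebesgue_rV N]_(x in A) (`|monomial j x| * f x)%:E < +oo)%E.
Implicit Types (p q r : mpoly N R).
Local Notation inner := (inner A f).
Local Notation Pi := (@Pi R N).

Lemma innerC p q : inner p q = inner q p.
Proof. by apply: eq_Rintegral => x _; rewrite [peval p x * _]mulrC. Qed.

Lemma inner_linear a p q r : inner (a *: p + q) r = a * inner p r + inner q r.
Proof.
have int p1 p2 : (lebesgue_rV N).-integrable A
    (EFin \o (fun x => peval p1 x * peval p2 x * f x)).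
  apply: (eq_integrable mA (fun x => (peval (p1 * p2) x * f x)%:E)) => //.
    by move=> x _; rewrite pevalM.
  exact: (integrable_peval mA f_ge0 moments).
rewrite /Defs.inner -(RintegralZl _ mA (int _ _)) -(RintegralD mA _ (int _ _)).
  by apply: eq_Rintegral => x _; rewrite pevalD pevalZ; ring.
apply: (eq_integrable mA
  (fun x => a%:E * (peval p x * peval r x * f x)%:E)%E) => //.
by apply: integrableZl => //; exact: int.
Qed.

Lemma inner0 p : inner 0 p = 0.
Proof.
by have := inner_linear (-1) 0 0 p; rewrite scaler0 addr0 mulN1r addNr.
Qed.

Lemma inner_ge0 p : 0 <= inner p p.
Proof. by apply: Rintegral_ge0 => x _; rewrite mulr_ge0// -expr2 sqr_ge0. Qed.

Lemma Pi_mono l m : (l <= m)%N -> Pi l `<=` Pi m.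
Proof.
move=> lm; apply: lspan_sub; first exact: linear_lspan.
move=> _ [j /= jl <-]; apply: sub_lspan; exists j => //=; exact: leq_trans lm.
Qed.

Lemma Pi_msize p : Pi (msize p) p.
Proof.
have [P0 PL] := linear_lspan (R := R)
  [set mpolyX R j | j in [set j : multinom N | (mdeg j <= msize p)%N]].
rewrite {2}(mpolyE p) big_seq; elim/big_ind : _ => [||m mp]; first exact: P0.
  by move=> u v; apply: linear_setD.
apply: linear_setZ => //; apply: sub_lspan; exists m => //=.
exact/ltnW/msize_mdeg_lt.
Qed.

Lemma sub_Vspace_Pi l : Vspace A f l `<=` Pi l.
Proof.
case: l => [|l]; last by move=> p [].
apply: lspan_sub; first exact: linear_lspan.
move=> _ ->; apply: sub_lspan; exists mnm0; last exact: mpolyX0.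
by rewrite /= mdeg0.
Qed.

Lemma linear_Vspace l : linear_set (Vspace A f l).
Proof.
case: l => [|l]; first exact: linear_lspan.
have [P0 PL] := linear_lspan
  [set mpolyX R j | j in [set j : multinom N | (mdeg j <= l.+1)%N]].
split.
  split=> [|q Pq]; first exact: P0.
  exact: inner0.
move=> a p q [Pp Op] [Pq Oq]; split; first exact: PL.
by move=> r Pr; rewrite inner_linear Op// Oq// mulr0 addr0.
Qed.

Lemma mutually_orthogonal_Vspace : mutually_orthogonal A f (Vspace A f).
Proof.
have H k l p q : (k < l)%N -> Vspace A f k p -> Vspace A f l q -> inner q p = 0.
  case: l => // l; rewrite ltnS => kl Vp [_]; apply.
  exact: Pi_mono kl _ (sub_Vspace_Pi Vp).
move=> k l p q; rewrite neq_ltn => /orP[kl|lk] Vp Vq; last exact: H lk Vq Vp.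
by rewrite innerC; exact: H kl Vp Vq.
Qed.

(** The monomials of degree at most l are finitely many and span Pi l. *)
Lemma Pi_projection l p :
  exists2 w, Pi l w & forall q, Pi l q -> inner (p - w) q = 0.
Proof.
pose s := [seq mpolyX R (bmnm m) | m : bmultinom N l.+1].
have [||w Pw ws] := semidefinite_projection innerC inner_linear inner_ge0
  (s := s) (W := Pi l) p.
- exact: linear_lspan.
- move=> _ /mapP[m _ ->]; apply: sub_lspan; exists (bmnm m) => //=.
  by rewrite -ltnS; exact: bmdeg.
exists w => //; apply: lspan_sub.
  split=> [|a u v u0 v0]; rewrite innerC; first exact: inner0.
  by rewrite inner_linear [inner u _]innerC [inner v _]innerC u0 v0 mulr0 addr0.
move=> _ [j /= jl <-]; apply: ws; apply/mapP.
by exists (BMultinom (jl : (mdeg j < l.+1)%N)) => //; rewrite mem_enum.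
Qed.

(** The part of a polynomial of degree at most l.+1 that is orthogonal to Pi l
    belongs to the space of degree l.+1, and the projection on Pi l has a
    smaller degree. *)
Lemma Pi_orthogonal_decomposition l p : Pi l p ->
  exists2 q : nat -> mpoly N R, (forall k, Vspace A f k (q k)) &
    p = \sum_(k < l.+1) q k.
Proof.
elim: l p => [|l IH] p Pp.
  exists (fun k => if k is 0%N then p else 0); last by rewrite big_ord1.
  move=> [|k]; last by case: (linear_Vspace k.+1).
  move: Pp; apply: lspan_sub; first exact: linear_lspan.
  move=> _ [j /= j0 <-]; apply: sub_lspan => /=.
  by move: j0; rewrite leqn0 mdeg_eq0 => /eqP ->; exact: mpolyX0.
have [w Pw pw] := Pi_projection l p; have [q Vq wq] := IH _ Pw.
exists (fun k => if k == l.+1 then p - w else q k).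
  move=> k; case: eqP => [->|_]; last exact: Vq.
  split => //; apply: linear_setB => //; first exact: linear_lspan.
  exact: Pi_mono Pw.
rewrite big_ord_recr/= eqxx (eq_bigr (fun k : 'I_l.+1 => q k)).
  by rewrite -wq addrC subrK.
by move=> k _; rewrite ltn_eqF.
Qed.

Lemma algebraic_sum_Vspace : algebraic_sum (Vspace A f) = setT.
Proof.
apply/seteqP; split => // p _.
have [q Vq pq] := Pi_orthogonal_decomposition (Pi_msize p).
by exists (msize p).+1, q.
Qed.

End orthogonal_sum.

(** * Square-integrable classes and the density theorem *)

Section L2_space.
Context d (T : measurableType d) (R : realType).
Variable mu : {measure set T -> \bar R}.

Lemma Lnorm2E (u : T -> R) :
  'N[mu]_(2%:R)%:E[EFin \o u]%E = (sqint mu u `^ 2^-1)%E.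
Proof.
rewrite unlock /Lnorm /sqint.
by under eq_integral do rewrite /= powR_mulrn// real_normK ?num_real//.
Qed.

Lemma Lnorm2_lt (u : T -> R) (e : R) : 0 < e ->
  (sqint mu u < (e ^+ 2)%:E)%E -> ('N[mu]_(2%:R)%:E[EFin \o u] < e%:E)%E.
Proof.
move=> e0 ue; rewrite Lnorm2E.
have fin : sqint mu u \is a fin_num.
  by rewrite ge0_fin_numE ?sqint_ge0//; exact: lt_trans ue (ltry _).
move: ue; rewrite -(fineK fin) poweR_EFin !lte_fin => ue.
rewrite [ltRHS](_ : e = (e ^+ 2) `^ 2^-1); last first.
  by rewrite -powR_mulrn ?ltW// -powRrM mulfV// powRr1// ltW.
by rewrite gt0_ltr_powR ?invr_gt0 ?nnegrE ?sqr_ge0 ?fine_ge0 ?sqint_ge0.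
Qed.

Lemma ae_eq_sqint (u v : T -> R) :
  measurable_fun setT u -> measurable_fun setT v ->
  {ae mu, forall x, u x = v x} -> sqint mu u = sqint mu v.
Proof.
move=> mu_ mv uv; apply: ae_eq_integral => //; try exact: measurable_sqr.
by apply: filterS uv => x uvx _ /=; rewrite uvx.
Qed.

Lemma measurable_Lspace (g : LspaceType2 mu) : measurable_fun setT (g : T -> R).
Proof.
exact: (measurable_funPT (repr (g : {mfun_ mu, T >-> measurableTypeR R}))).
Qed.

Lemma Lspace_square_integrable (g : LspaceType2 mu) : square_integrable mu g.
Proof.
split; first exact: measurable_Lspace.
have := @Lebesgue_finite _ _ _ _ _ _ g; rewrite /finite_norm Lnorm2E.
exact: lty_poweRy.
Qed.

(** The representative of the class of u is chosen arbitrarily: it agrees with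
    u almost everywhere only. *)
Lemma Lspace_class (u : T -> R) : square_integrable mu u ->
  exists g : LspaceType2 mu, {ae mu, forall x, g x = u x}.
Proof.
move=> [mu_ iu].
pose u0 : {mfun T >-> measurableTypeR R} :=
  HB.pack u (@isMeasurableFun.Build _ _ T (measurableTypeR R) u mu_).
pose c : {mfun_ mu, T >-> measurableTypeR R} :=
  (\pi_{mfun_ mu, T >-> measurableTypeR R} u0)%qT.
have cu : {ae mu, forall x, c x = u x}.
  have /eqmodP/asboolP :
      (repr c = u0 %[mod {mfun_ mu, T >-> measurableTypeR R}])%qT.
    by rewrite reprK.
  by apply: filterS => x; exact.
have cfin : finite_norm mu 2%:R%:E c.
  rewrite /finite_norm Lnorm2E (@ae_eq_sqint _ u)//.
    by apply: poweR_lty.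
  exact: (measurable_funPT (repr c)).
pose g : LspaceType2 mu :=
  HB.pack c (isFinLebesgue.Build _ _ _ mu _ (lee1n 2) c cfin).
by exists g.
Qed.

End L2_space.

Section polynomial_approximation.
Context (R : realType) (N : nat) d (Omega : measurableType d)
  (Pr : probability Omega R).
Variables (A : set 'rV[R]_N) (mA : measurable A) (X : {RV Pr >-> 'rV[R]_N})
  (f : {mfun 'rV[R]_N >-> R}).
Hypothesis f_ge0 : forall x, 0 <= f x.
Hypothesis assumption1 : density_assumption A X f.
Local Notation mu := (density_on f_ge0 mA).

(** The assumption on exponential moments bounds a norm, hence each
    coordinate. In the case of compact support the coordinates are bounded
    almost everywhere, because the mass of the complement of K is a
    probability equal to 0. *)
Lemma density_assumption_exp_integrable i :
  exp_integrable mu (fun x : 'rV[R]_N => x ord0 i).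
Proof.
have moments := da_moments assumption1.
have [[K cK PK]|[nrm [nn [alpha a0 ai]]]] := da_tail assumption1; last first.
  exact: (exp_integrable_coord_norm _ _ nn a0 ai).
apply: (exp_integrable_coord_bounded moments cK).
have mK := measurable_compact_rV cK.
apply/eqP; rewrite eq_le measure_ge0 andbT.
have <- : distribution Pr X (~` K) = 0%E.
  by rewrite probability_setC// [X in (_ - X)%E](_ : _ = 1%E) ?subee.
rewrite (da_density assumption1); last exact: measurableC.
apply: ge0_subset_integral => //.
- by apply: measurableI => //; exact: measurableC.
- exact: measurableC.
- by apply/measurable_EFinP; exact: measurable_funTS.
- by move=> x _; rewrite lee_fin.
Qed.

Lemma polynomial_class_near (g : LspaceType2 mu) (e : R) : 0 < e ->
  exists2 h, L2_classes mu setT h & Lspace_ball g e h.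
Proof.
move=> e0; have [mg Vg] := L2closure_polynomials (da_moments assumption1)
  density_assumption_exp_integrable (Lspace_square_integrable g).
have e20 : 0 < e ^+ 2 by rewrite exprn_gt0.
have [_ [p _ <-] gp] := Vg _ e20.
have ip := square_integrable_peval mA f_ge0 (da_moments assumption1) p.
have [h hp] := Lspace_class ip; exists h; first by exists p.
apply: Lnorm2_lt => //; rewrite (ae_eq_sqint (v := fun x => g x - peval p x))//.
- by apply: measurable_funB => //; exact: measurable_Lspace.
- by apply: measurable_funB => //; case: ip.
- by apply: filterS hp => x ->.
Qed.

End polynomial_approximation.

Lemma closure_Lspace2_setT d (T : measurableType d) (R : realType)
    (mu : {measure set T -> \bar R}) (C : set (LspaceType2 mu)) :
  (forall (g : LspaceType2 mu) (e : R), 0 < e ->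
    exists2 h, C h & Lspace_ball g e h) ->
  closure C = [set: LspaceType2 mu].
Proof.
move=> Cnear; apply/seteqP; split => // g _ U /nbhs_ballP[e /= e0 gU].
by have [h Ch gh] := Cnear g e e0; exists h; split => //; exact: gU.
Qed.

Theorem proposition4 (R : realType) (N : nat) (N_gt0 : (0 < N)%N)
    (d : measure_display) (Omega : measurableType d) (Pr : probability Omega R)
    (Pr_complete : measure_is_complete Pr)
    (A : set 'rV[R]_N) (A_domain : subdomain A) (A_borel : measurable A)
    (X : {RV Pr >-> 'rV[R]_N}) (X_in_A : forall w, A (X w))
    (f : {mfun 'rV[R]_N >-> R}) (f_ge0 : forall x, 0 <= f x)
    (assumption1 : density_assumption A X f)
    (e : forall l, 'I_(nb_monomials (N := N) l) -> multinom N)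
    (e_listing : monomial_listing e)
    (P : multinom N -> mpoly N R)
    (P_orthogonal : orthogonal_polynomials A f e P)
    (P_basis : forall l, basis_of_subspace (degree_set l) P (Vspace A f l)) :
  let mu := density_on f_ge0 A_borel in
  let spanP := fun l => lspan (P @` degree_set l) in
  [/\ mutually_orthogonal A f spanP,
      dense (L2_classes mu (algebraic_sum spanP)),
      mutually_orthogonal A f (Vspace A f) &
      [set: LspaceType2 mu] =
        closure (L2_classes mu (algebraic_sum (Vspace A f)))].
Proof.
move=> mu spanP.
(* The spans of the P_j of degree l are the spaces V_l as these form bases. *)
have spanE : spanP = Vspace A f by apply/funext => l; case: (P_basis l).
have moments := da_moments assumption1.
have orthV : mutually_orthogonal A f (Vspace A f).
  exact: mutually_orthogonal_Vspace.
have sumV : algebraic_sum (Vspace A f) = setT.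
  exact: algebraic_sum_Vspace.
have closV : closure (L2_classes mu (algebraic_sum (Vspace A f))) = setT.
  rewrite sumV; apply: closure_Lspace2_setT => g r r0.
  exact: (polynomial_class_near assumption1).
rewrite spanE; split => //.
move=> O [g Og] oO.
have : closure (L2_classes mu (algebraic_sum (Vspace A f))) g by rewrite closV.
by move=> /(_ O (open_nbhs_nbhs (conj oO Og)))[h [Ch Oh]]; exists h.
Qed.
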